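(* Let $T>0$, let $(U,d_U)$ be a compact metric space, and let $f:\mathbb{R}^d\times U\to\mathbb{R}^d$ satisfy: (i) $f$ is continuous and there exists $m>0$ such that $|f(x,u)|\le m(1+|x|)$ for all $(x,u)\in\mathbb{R}^d\times U$; (ii) for each compact set $K\subset\mathbb{R}^d$ there exists $\ell_K>0$ such that $|f(x,u)-f(y,u)|\le \ell_K|x-y|$ for all $x,y\in K$ and $u\in U$. Let $\mathcal{K}_{(\tau,t)}$ and $\mathcal{L}$ be the associated set-valued Koopman and Liouville operators, and fix some $\tau\in[0,T]$. Then for all times $t\in[\tau,T]$, one has that $$e^{\sigma_p(\mathcal{L})(t-\tau)}\subset\sigma_p(\mathcal{K}_{(\tau,t)}),$$ namely if an observable $\varphi_\lambda\in\mathcal{D}$ is an eigenfunction of $\mathcal{L}:\mathcal{D}\rightrightarrows\mathcal{X}$ with eigenvalue $\lambda\in\sigma_p(\mathcal{L})$, then it is an eigenfunction of $\mathcal{K}_{(\tau,t)}:\mathcal{X}\rightrightarrows\mathcal{X}$ with eigenvalue $e^{\lambda(t-\tau)}\in\sigma_p(\mathcal{K}_{(\tau,t)})$. Furthermore, if the set of controlled vector fields $\mathcal{F}:=\{f_u\in C^0(\mathbb{R}^d,\mathbb{R}^d)~:~u\in U\}$ is convex, then for each Lebesgue-measurable curve $t\in[0,T]\mapsto\lambda_{(\tau,t)}\in\mathbb{C}$ satisfying $$\lambda_{(\tau,t)}\varphi_\lambda\in\mathcal{K}_{(\tau,t)}(\varphi_\lambda)$$ for some given time-independent $\varphi_\lambda\in\mathcal{D}$,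 there exists a sequence $t_n\to\tau$ for which $$\lim_{n\to+\infty}\lambda_{(\tau,t_n)}=1\qquad\text{and}\qquad\lim_{n\to+\infty}\frac{\lambda_{(\tau,t_n)}-1}{t_n-\tau}\in\sigma_p(\mathcal{L}).$$ In particular, the converse spectral inclusion $$\Big\{e^{\lambda(t-\tau)}\in\mathbb{C}~:~e^{\lambda(t-\tau)}\varphi_\lambda\in\mathcal{K}_{(\tau,t)}(\varphi_\lambda)\text{ with }\lambda\in\mathbb{C}\Big\}\subset e^{\sigma_p(\mathcal{L})(t-\tau)}$$ holds for all times $\tau,t\in[0,T]$.
   Context: For $u\in U$, $f_u:=f(\cdot,u)$. $\mathcal{X}:=C^0_c(\mathbb{R}^d,\mathbb{C})$ is the space of continuous complex-valued functions (observables) with compact support, with the supremum norm, and $\mathcal{D}:=C^1_c(\mathbb{R}^d,\mathbb{C})$ is the space of continuously differentiable complex-valued functions with compact support, with the corresponding $C^1$ norm. $\mathcal{U}$ is the set of Lebesgue-measurable maps $u:[0,T]\to U$. For $u(\cdot)\in\mathcal{U}$, the controlled flow $(\Phi^u_{(\tau,t)})_{\tau,t\in[0,T]}\subset C^0(\mathbb{R}^d,\mathbb{R}^d)$ is the unique solution of $\Phi^u_{(\tau,t)}(x)=x+\int_\tau^t f(\Phi^u_{(\tau,s)}(x),u(s))\,ds$ for all $\tau,t\in[0,T]$, $x\in\mathbb{R}^d$. The set-valued Koopman operators are $\mathcal{K}_{(\tau,t)}(\varphi):=\{\varphi\circ\Phi^u_{(\tau,t)}~:~u(\cdot)\in\mathcal{U}\}\subset\mathcal{X}$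 for $\varphi\in\mathcal{X}$, and the set-valued Liouville operator is $\mathcal{L}(\varphi):=\{\nabla_x\varphi\cdot f_u~:~u\in U\}\subset\mathcal{X}$ for $\varphi\in\mathcal{D}$. For a closed process $F:\mathcal{E}\rightrightarrows\mathcal{Y}$ between Banach spaces (a set-valued map whose graph is a closed cone), $\lambda\in\mathbb{C}$ is an eigenvalue of $F$ if there exists an eigenvector (or eigenfunction) $x_\lambda\in\mathcal{E}\setminus\{0\}$ such that $\lambda x_\lambda\in F(x_\lambda)$; the set of eigenvalues is the point spectrum $\sigma_p(F)\subset\mathbb{C}$. This terminology is used in the same way for $\mathcal{L}:\mathcal{D}\rightrightarrows\mathcal{X}$ and $\mathcal{K}_{(\tau,t)}:\mathcal{X}\rightrightarrows\mathcal{X}$. For $S\subset\mathbb{C}$ and $r\in\mathbb{R}$, $e^{Sr}:=\{e^{\lambda r}~:~\lambda\in S\}$. In the last set of the claim, $\varphi_\lambda$ denotes an observable in $\mathcal{D}$.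
   Formalization: In the converse inclusion, the condition defining the left-hand set is required with one fixed nonzero φ_λ for all times s in [0,T] (the whole curve e^{λ(s-τ)}), since imposed only at the single time t it is false (e.g. t=τ, d=1, f=1); φ_λ is taken nonzero. *)

(* Defs.v *)
From HB Require Import structures.
From mathcomp Require Export all_boot all_order all_algebra.
From mathcomp Require Export all_classical all_reals all_analysis.
From mathcomp Require Export complex.

Set Implicit Arguments.
Unset Strict Implicit.
Unset Printing Implicit Defensive.

Export Order.TTheory GRing.Theory Num.Theory.
Export numFieldNormedType.Exports.
Local Open Scope classical_set_scope.
Local Open Scope ring_scope.
Local Open Scope complex_scope.

(* The regular module R[i]^o, and not R[i] itself, carries the topology. *)
Notation Cplx R := ((R[i])^o).

Definition cexp (R : realType) (z : Cplx R) : Cplx R :=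
  (expR (complex.Re z))%:C *
  (cos (complex.Im z) +i* sin (complex.Im z)).

(* F is read as a set-valued map from E to V: only its values on E matter. *)
Definition eigenvector (K : numFieldType) (V : lmodType K)
    (E : set V) (F : V -> set V) (lambda : K) (x : V) : Prop :=
  [/\ E x, x != 0 & F x (lambda *: x)].

Definition point_spectrum (K : numFieldType) (V : lmodType K)
    (E : set V) (F : V -> set V) : set K :=
  [set lambda | exists x : V, eigenvector E F lambda x].

Definition exp_scaled (R : realType) (S : set (Cplx R)) (r : R) :
    set (Cplx R) :=
  [set cexp (lambda * r%:C) | lambda in S].

Section observables.
Context (R : realType) (d : nat).
Local Notation obs := ('rV[R]_d -> Cplx R).

Definition compact_support (phi : obs) : Prop :=
  compact (closure [set x | phi x != 0]).

Definition C0c : set obs :=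
  [set phi | continuous phi /\ compact_support phi].

Definition re_part (phi : obs) (x : 'rV[R]_d) : R := complex.Re (phi x).
Definition im_part (phi : obs) (x : 'rV[R]_d) : R := complex.Im (phi x).

(* R[i] is not a normed module over R in the library, so that the real
   derivatives of an observable are taken on its real and imaginary parts. *)
Definition partial (phi : obs) (i : 'I_d) (x : 'rV[R]_d) : Cplx R :=
  'D_(delta_mx 0 i) (re_part phi) x +i* 'D_(delta_mx 0 i) (im_part phi) x.

Definition C1c : set obs :=
  [set phi | [/\ forall x, differentiable (re_part phi) x,
                 forall x, differentiable (im_part phi) x,
                 forall i, continuous (partial phi i) &
                 compact_support phi]].

Definition grad_dot (phi : obs) (v : 'rV[R]_d -> 'rV[R]_d) : obs :=
  fun x => \sum_(i < d) partial phi i x * (v x 0 i)%:C.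

End observables.

(* The source carries the complete Lebesgue sigma-algebra, the target its
   Borel sets; measurable_fun would force V to be pointed, hence nonempty. *)
Definition lebesgue_measurable (R : realType) (V : topologicalType)
    (D : set R) (g : R -> V) : Prop :=
  forall B : set V, <<s open >> B ->
    (@wlength R idfun)^*%mu.-cara.-measurable (D `&` g @^-1` B).

Definition oriented_integral (R : realType) (a b : R) (h : R -> R) : R :=
  if a <= b
  then \int[@completed_lebesgue_measure R]_(s in `[a, b]) h s
  else - \int[@completed_lebesgue_measure R]_(s in `[b, a]) h s.

Section control_system.
Context (R : realType) (d : nat) (U : metricType R).
Context (f : 'rV[R]_d * U -> 'rV[R]_d) (T : R).
Local Notation obs := ('rV[R]_d -> Cplx R).

(* Controls are total functions on R of which only the restriction to [0, T]
   matters. *)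
Definition admissible (u : R -> U) : Prop :=
  lebesgue_measurable `[0, T] u.

(* Phi tau t is the flow map from time tau to time t; it is only constrained
   for tau and t in [0, T]. *)
Definition controlled_flow (u : R -> U)
    (Phi : R -> R -> 'rV[R]_d -> 'rV[R]_d) : Prop :=
  forall tau t : R, tau \in `[0, T] -> t \in `[0, T] ->
    continuous (Phi tau t) /\
    forall (x : 'rV[R]_d) (i : 'I_d),
      let h := fun s : R => f (Phi tau s x, u s) 0 i in
      (@completed_lebesgue_measure R).-integrable
        `[Num.min tau t, Num.max tau t] (EFin \o h) /\
      Phi tau t x 0 i = x 0 i + oriented_integral tau t h.

Definition Koopman (tau t : R) (phi : obs) : set obs :=
  [set psi | exists (u : R -> U) (Phi : R -> R -> 'rV[R]_d -> 'rV[R]_d),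
    [/\ admissible u, controlled_flow u Phi & psi = phi \o Phi tau t]].

Definition Liouville (phi : obs) : set obs :=
  [set grad_dot phi (fun x => f (x, u)) | u in [set: U]].

Definition controlled_fields : set ('rV[R]_d -> 'rV[R]_d) :=
  [set (fun x => f (x, u)) | u in [set: U]].

Definition Koopman_spectrum (tau t : R) : set (Cplx R) :=
  point_spectrum (@C0c R d) (Koopman tau t).

Definition Liouville_spectrum : set (Cplx R) :=
  point_spectrum (@C1c R d) Liouville.

(* The same nonzero observable phi has to satisfy the inclusion along the whole
   curve s |-> exp (lambda (s - tau)): at a single time it carries no
   information (for t = tau every lambda qualifies). *)
Definition exponential_Koopman_values (tau t : R) : set (Cplx R) :=
  [set cexp (lambda * (t - tau)%:C) | lambda in
    [set lambda : Cplx R | exists phi : obs,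
      [/\ C1c phi, phi != 0 &
        forall s : R, s \in `[0, T] ->
          Koopman tau s phi (cexp (lambda * (s - tau)%:C) *: phi)]]].

End control_system.

(* Main.v *)
Require Import Defs.
From mathcomp Require Import measurable_realfun ring lra.

Set Implicit Arguments.
Unset Strict Implicit.
Unset Printing Implicit Defensive.

Local Open Scope classical_set_scope.
Local Open Scope ring_scope.
Local Open Scope complex_scope.

(** Direct inclusion. If lambda * phi = grad phi . f_u for one value u, use the
    constant control u. Along a trajectory x of the autonomous field f_u the
    chain rule gives (phi o x)' = (grad phi . f_u) o x = lambda * (phi o x), a
    linear planar system whose only solution is exp (lambda t) * phi (x 0); see
    [eigen_along_flow]. What has to be built is the flow itself. The
    Picard iterates of f_u are defined on the whole line: linear growth keeps
    them in a ball that depends only on the size of the initial point and of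
    the time interval ([picard_radius]), and on that ball the field is
    Lipschitz. All estimates use the weight exp (K t) + exp (- K t): a function
    bounded by C times the weight has an integral from 0 bounded by C / K times
    the weight ([oriented_integral_weight]), so that each iteration halves the
    error for K = 2 L, uniformly on long intervals and for both signs of the
    time. The same contraction, applied to two initial points, bounds the
    dependence on the initial point of every iterate, hence of the limit, which
    makes the flow maps continuous.

    Converse. Let lambda_t phi = phi o Phi_t where Phi_t is the flow map from
    tau to t of a control that may change with t. Since trajectories leave
    their starting point at bounded speed, the quotients
    q_t = (lambda_t - 1) / (t - tau) are bounded near tau, and Bolzano and
    Weierstrass give times t_n tending to tau along which they converge to
    some mu. To see that mu belongs to the spectrum of the Liouville operator,
    one needs a single value u with mu phi (x) = grad phi (x) . f (x, u) for
    all points x. Any linear inequality satisfied, for finitely many points x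
    and all u in U, by the numbers grad phi (x) . f (x, u) is inherited by
    the numbers mu phi (x): the increments of phi along the trajectories are
    averages of the former numbers, up to an error that vanishes with t - tau
    ([increments_expansion]). For finitely many points, the set of values taken
    as u varies is convex and compact, so the point that satisfies all these
    inequalities lies in it; this is shown by minimising a sum of squares over
    U ([convex_realisation_finite]). Compactness of U then provides one u that
    works for all points at once ([convex_realisation]). For
    lambda_t = exp (lambda (t - tau)) the quotients converge to lambda, whence
    the last inclusion. *)

(** * Integrals with respect to the completed Lebesgue measure *)

Section measure.
Context (R : realType).
Local Notation mu := (@completed_lebesgue_measure R).
Local Notation cmeas := ((@wlength R idfun)^*%mu.-cara.-measurable).

Lemma borel_completed (A : set R) :
  @measurable _ (measurableTypeR R) A -> cmeas A.
Proof. exact: sub_caratheodory. Qed.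

Lemma itv_completed (i : interval R) : cmeas [set` i].
Proof. by apply: borel_completed; exact: measurable_itv. Qed.

Lemma completed_measure_itv (i : interval R) :
  mu [set` i] = @lebesgue_measure R [set` i].
Proof. by []. Qed.

Lemma continuous_integrable (g : R -> R) (a b : R) : continuous g ->
  mu.-integrable `[a, b] (EFin \o g).
Proof.
move=> cg.
apply: measurable_bounded_integrable; first exact: itv_completed.
- rewrite /= completed_measure_itv lebesgue_measure_itv.
  by case: ifP => //= _; rewrite ltry.
- move=> _ B mB; apply: borel_completed.
  apply: measurableI; first exact: measurable_itv.
  by rewrite -[X in measurable X]setTI; apply: (continuous_measurable_fun cg).
- have /compact_bounded : compact (g @` `[a, b]).
    apply: continuous_compact; last exact: segment_compact.
    exact: continuous_subspaceT.
  by case=> M [Mr Mg]; exists M; split => // x Mx y /= yab; apply: (Mg x Mx); exists y.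
Qed.

Lemma completed_null_point (b : R) : mu [set b] = 0%E.
Proof.
by rewrite -set_itv1 completed_measure_itv set_itv1 lebesgue_measure_set1.
Qed.

Lemma Rintegral_itv_split (h : R -> R) (a b c : R) : a <= b -> b <= c ->
  mu.-integrable `[a, c] (EFin \o h) ->
  \int[mu]_(x in `[a, c]) h x =
  \int[mu]_(x in `[a, b]) h x + \int[mu]_(x in `]b, c]) h x.
Proof.
move=> ab bc hi.
have E : `[a, c]%classic = `[a, b]%classic `|` `]b, c]%classic.
  by rewrite -itv_bndbnd_setU ?bnd_simp.
rewrite E Rintegral_setU //; try exact: itv_completed.
  by rewrite -E.
apply/disj_setPS => y [/=]; rewrite 2!in_itv/= => /andP[_ yx] /andP[].
by rewrite ltNge yx.
Qed.

Lemma Rintegral_itv_closed (h : R -> R) (b c : R) : b <= c ->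
  mu.-integrable `[b, c] (EFin \o h) ->
  \int[mu]_(x in `[b, c]) h x = \int[mu]_(x in `]b, c]) h x.
Proof.
move=> bc hi; rewrite (Rintegral_itv_split (lexx b) bc hi) set_itv1.
suff -> : \int[mu]_(x in [set b]) h x = 0 by exact: add0r.
rewrite /Rintegral.
suff -> : (\int[mu]_(x in [set b]) (h x)%:E = 0)%E by [].
apply: null_set_integral; last exact: completed_null_point.
- by rewrite -set_itv1; exact: itv_completed.
- rewrite -set_itv1.
  apply: (measurable_funS _ _ (measurable_int _ hi)); first exact: itv_completed.
  by apply: subset_itvl; rewrite bnd_simp.
Qed.

Lemma integrable_itvS (h : R -> R) (a b a' b' : R) : a <= a' -> b' <= b ->
  mu.-integrable `[a, b] (EFin \o h) -> mu.-integrable `[a', b'] (EFin \o h).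
Proof.
move=> aa bb; apply: integrableS; try exact: itv_completed.
by apply: subset_itv; rewrite bnd_simp.
Qed.

(** A common left end B turns both orientations into the same difference, so that
    additivity follows by cancellation whatever the order of the bounds. *)
Lemma oriented_integralE (h : R -> R) (B C a t : R) :
  mu.-integrable `[B, C] (EFin \o h) -> B <= a <= C -> B <= t <= C ->
  oriented_integral a t h =
  \int[mu]_(x in `[B, t]) h x - \int[mu]_(x in `[B, a]) h x.
Proof.
move=> hi /andP[Ba aC] /andP[Bt tC]; rewrite /oriented_integral.
case: ifPn => [at_|]; last rewrite -ltNge => /ltW ta.
- rewrite (Rintegral_itv_split Ba at_); last exact: (integrable_itvS _ tC hi).
  rewrite Rintegral_itv_closed//; last exact: (integrable_itvS Ba tC hi).
  by move: (Rintegral _ _ _) (Rintegral _ _ _) => x y; lra.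
- rewrite (Rintegral_itv_split Bt ta); last exact: (integrable_itvS _ aC hi).
  rewrite Rintegral_itv_closed//; last exact: (integrable_itvS Bt aC hi).
  by move: (Rintegral _ _ _) (Rintegral _ _ _) => x y; lra.
Qed.

Lemma completed_itv_length (a b : R) : a <= b -> fine (mu `[a, b]) = b - a.
Proof.
move=> ab; rewrite completed_measure_itv lebesgue_measure_itv /= lte_fin.
by case: ltgtP ab => // -> _; rewrite subrr.
Qed.

Lemma Rintegral_itv_le (h : R -> R) (a b M : R) : a <= b ->
  mu.-integrable `[a, b] (EFin \o h) -> (forall x, a <= x <= b -> h x <= M) ->
  \int[mu]_(x in `[a, b]) h x <= M * (b - a).
Proof.
move=> ab hi hM; rewrite -completed_itv_length// -Rintegral_cst; last exact: itv_completed.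
apply: le_Rintegral => //; first exact: itv_completed.
  by apply: continuous_integrable; exact: cst_continuous.
Qed.

Definition between (a b s : R) := Num.min a b <= s <= Num.max a b.

(** Dividing by b - a turns the oriented integral into an average, so that the
    bound does not depend on the order of a and b. *)
Lemma oriented_integral_le (h : R -> R) (a b M : R) : a != b ->
  mu.-integrable `[Num.min a b, Num.max a b] (EFin \o h) ->
  (forall s, between a b s -> h s <= M) ->
  oriented_integral a b h / (b - a) <= M.
Proof.
rewrite /between /oriented_integral => ab hi hM.
have [ab'|ba] := ltP a b.
  rewrite (ltW ab') ler_pdivrMr ?subr_gt0 //.
  move: hi hM; rewrite minElt maxElt ab' => hi hM.
  by apply: Rintegral_itv_le => //; rewrite ltW.
have {}ba : b < a by rewrite lt_neqAle eq_sym ab.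
rewrite [a <= b]leNgt ba /= mulNr -mulrN -invrN opprB ler_pdivrMr ?subr_gt0 //.
move: hi hM; rewrite minElt maxElt ltNge (ltW ba) /= => hi hM.
by apply: Rintegral_itv_le => //; rewrite ltW.
Qed.

Lemma oriented_integralZ (h : R -> R) (a b k : R) :
  mu.-integrable `[Num.min a b, Num.max a b] (EFin \o h) ->
  oriented_integral a b (fun s => k * h s) = k * oriented_integral a b h.
Proof.
move=> hi; rewrite /oriented_integral; case: ifPn => [ab|].
  by rewrite RintegralZl//; [exact: itv_completed | move: hi; rewrite min_l// max_r].
rewrite -ltNge => /ltW ba.
by rewrite RintegralZl ?mulrN//; [exact: itv_completed | move: hi; rewrite min_r// max_l].
Qed.

Lemma oriented_integralD (h k : R -> R) (a b : R) :
  mu.-integrable `[Num.min a b, Num.max a b] (EFin \o h) ->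
  mu.-integrable `[Num.min a b, Num.max a b] (EFin \o k) ->
  oriented_integral a b (fun s => h s + k s) =
  oriented_integral a b h + oriented_integral a b k.
Proof.
rewrite /oriented_integral; case: ifPn => [ab|].
  rewrite min_l// max_r// => hi ki.
  by rewrite RintegralD//; exact: itv_completed.
rewrite -ltNge => /ltW ba; rewrite min_r// max_l// => hi ki.
by rewrite RintegralD ?opprD//; exact: itv_completed.
Qed.

Lemma oriented_integral_sum (I : Type) (r : seq I) (h : I -> R -> R)
    (k : I -> R) (a b : R) :
  (forall i, mu.-integrable `[Num.min a b, Num.max a b] (EFin \o h i)) ->
  oriented_integral a b (fun s => \sum_(i <- r) k i * h i s) =
    \sum_(i <- r) k i * oriented_integral a b (h i) /\
  mu.-integrable `[Num.min a b, Num.max a b]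
    (EFin \o (fun s => \sum_(i <- r) k i * h i s)).
Proof.
move=> hi; have mI := @itv_completed `[Num.min a b, Num.max a b].
have ki i : mu.-integrable `[Num.min a b, Num.max a b] (EFin \o (fun s => k i * h i s)).
  by have := integrableZl mI (k i) (hi i); apply: eq_integrable.
elim: r => [|i r [IH1 IH2]].
  have -> : (fun s => \sum_(i <- [::]) k i * h i s) = cst 0.
    by apply/funext => s; rewrite big_nil.
  rewrite big_nil /oriented_integral; split.
    by rewrite !Rintegral_cst ?mul0r ?oppr0 ?if_same //; exact: itv_completed.
  by apply: continuous_integrable; exact: cst_continuous.
have E : (fun s => \sum_(j <- i :: r) k j * h j s) =
  (fun s => k i * h i s + \sum_(j <- r) k j * h j s).
  by apply/funext => s; rewrite big_cons.
rewrite E big_cons -IH1 oriented_integralD // oriented_integralZ //; split => //.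
by have := integrableD mI (ki i) IH2; apply: eq_integrable.
Qed.

Lemma between_swap (a b s c : R) : between a b s -> between a s c -> between a b c.
Proof.
rewrite /between.
by case: (leP a b) => ab; case: (leP a s) => as_; lra.
Qed.

Lemma between_norm (a b s : R) : between a b s -> `|s - a| <= `|b - a|.
Proof.
rewrite /between.
by case: (leP a b) => ab; case: (ger0P (s - a)) => ?; case: (ger0P (b - a)) => ?; lra.
Qed.

Lemma betweenr (a b : R) : between a b b.
Proof. by rewrite /between ge_min lexx orbT le_max lexx orbT. Qed.

Lemma oriented_integral_norm_le (h : R -> R) (a b M : R) :
  mu.-integrable `[Num.min a b, Num.max a b] (EFin \o h) ->
  (forall s, between a b s -> `|h s| <= M) ->
  `|oriented_integral a b h| <= M * `|b - a|.
Proof.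
move=> hi hM; have [->|ab] := eqVneq a b.
  have ib : mu.-integrable `[b, b] (EFin \o h).
    apply: integrableS hi; try exact: itv_completed.
    by apply: subset_itv; rewrite bnd_simp ?ge_min ?le_max lexx ?orbT.
  rewrite /oriented_integral lexx Rintegral_itv_closed // set_itv_ge ?bnd_simp ?ltxx //.
  by rewrite Rintegral_set0 normr0 subrr normr0 mulr0.
have up : oriented_integral a b h / (b - a) <= M.
  by apply: oriented_integral_le => // s /hM; rewrite ler_norml => /andP[].
have hNi : mu.-integrable `[Num.min a b, Num.max a b] (EFin \o (fun s => (-1) * h s)).
  have := integrableZl (@itv_completed _) (-1) hi.
  by apply: eq_integrable => //; exact: itv_completed.
have lo : oriented_integral a b (fun s => (-1) * h s) / (b - a) <= M.
  apply: oriented_integral_le => // s /hM; rewrite ler_norml => /andP[? ?]; lra.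
rewrite oriented_integralZ // mulN1r mulNr in lo.
have ba : 0 < `|b - a| by rewrite normr_gt0 subr_eq0 eq_sym.
by rewrite -ler_pdivrMr // -normf_div ler_norml lerNl lo up.
Qed.

(** The bound is the integral of the absolute value over the whole interval; it
    serves to know that a trajectory is bounded before any estimate on it is
    available. *)
Lemma oriented_integral_bounded (h : R -> R) (a b : R) :
  mu.-integrable `[Num.min a b, Num.max a b] (EFin \o h) ->
  exists B, forall s, between a b s -> `|oriented_integral a s h| <= B.
Proof.
move=> hi; pose I := `[Num.min a b, Num.max a b]%classic.
have hai : mu.-integrable I (EFin \o (fun s => `|h s|)).
  exact: integrable_norm hi.
exists (\int[mu]_(x in I) `|h x|) => s sab.
have key c e : Num.min a b <= c -> e <= Num.max a b ->
    `|\int[mu]_(x in `[c, e]) h x| <= \int[mu]_(x in I) `|h x|.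
  move=> ac eb; have sub : (`[c, e] `<=` I)%classic.
    by apply: subset_itv; rewrite bnd_simp.
  have hce := integrableS (@itv_completed _) (@itv_completed _) sub hi.
  apply: le_trans (le_normr_Rintegral (@itv_completed _) hce) _.
  rewrite /Rintegral fine_le //.
  - apply: integrable_fin_num; first exact: itv_completed.
    exact: (integrableS (@itv_completed _) (@itv_completed _) sub hai).
  - by apply: integrable_fin_num => //; exact: itv_completed.
  apply: ge0_subset_integral;
    [exact: itv_completed|exact: itv_completed|exact: measurable_int hai| |exact: sub].
  by move=> z _; rewrite lee_fin.
move: sab; rewrite /oriented_integral /between => /andP[s1 s2].
case: ifP => _; last rewrite normrN.
  by apply: key => //; rewrite ge_min lexx.
by apply: key => //; rewrite le_max lexx.
Qed.

End measure.

(** * Fundamental theorem of calculus *)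

Section ftc.
Context (R : realType).
Local Notation oint := (@oriented_integral R).

Lemma oriented_integral_chasles (g : R -> R) (a b c : R) : continuous g ->
  oint a c g - oint a b g = oint b c g.
Proof.
move=> cg; pose B := `|a| + `|b| + `|c|.
have bnd x : `|x| <= B -> - B <= x <= B by rewrite ler_norml.
have aB : - B <= a <= B by apply: bnd; rewrite /B -addrA lerDl addr_ge0.
have bB : - B <= b <= B by apply: bnd; rewrite /B addrAC lerDr addr_ge0.
have cB : - B <= c <= B by apply: bnd; rewrite /B lerDr addr_ge0.
have gi := @continuous_integrable R g (- B) B cg.
rewrite !(@oriented_integralE _ g (- B) B) //.
move: (Rintegral _ _ _) (Rintegral _ _ _) (Rintegral _ _ _) => x y z; lra.
Qed.

Lemma oriented_integral_same (g : R -> R) (a : R) : continuous g ->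
  oint a a g = 0.
Proof. by move=> cg; rewrite -(@oriented_integral_chasles g a a a cg) subrr. Qed.

Lemma oriented_integralB (g h : R -> R) (a t : R) : continuous g -> continuous h ->
  oint a t g - oint a t h = oint a t (fun s => g s - h s).
Proof.
move=> cg ch.
have -> : (fun s => g s - h s) = (fun s => g s + (-1) * h s).
  by apply/funext => s; rewrite mulN1r.
rewrite oriented_integralD ?oriented_integralZ ?mulN1r //;
  try exact: continuous_integrable.
by apply: continuous_integrable => s; apply: cvgM; [exact: cvg_cst|exact: ch].
Qed.

Lemma oriented_integral_derive (g : R -> R) (a t : R) : continuous g ->
  is_derive t (1 : R) (fun s => oint a s g) (g t).
Proof.
move=> cg.
have D : (fun h => h^-1 *: (oint a (h *: 1 + t) g - oint a t g)) @ 0^' --> g t.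
  apply/cvgrPdist_le => e e0.
  have /cvgrPdist_le/(_ e e0) [/= d d0 gd] := cg t.
  near=> h.
  have h0 : h != 0 by near: h; exact: nbhs_dnbhs_neq.
  have hd : `|h| < d by near: h; exact: dnbhs0_lt.
  rewrite oriented_integral_chasles //.
  have {}gd s : between t (h *: 1 + t) s -> `|g t - g s| <= e.
    move=> ts; apply: gd; rewrite /ball_ /=; apply: le_lt_trans hd.
    move: ts; rewrite /between [h *: 1]mulr1 ler_norml.
    by case: (leP t (h + t)) => th; case: (ger0P h) => hh; lra.
  have th : t != h *: 1 + t.
    by rewrite [h *: 1]mulr1 -subr_eq0 opprD addrCA subrr addr0 oppr_eq0.
  have cgN : continuous (fun s => (- 1) * g s).
    by move=> s; apply: cvgM; [exact: cvg_cst|exact: cg].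
  have up : oint t (h *: 1 + t) g / ((h *: 1 + t) - t) <= g t + e.
    apply: oriented_integral_le => //; first exact: continuous_integrable.
    by move=> s /gd; rewrite ler_norml; lra.
  have lo : oint t (h *: 1 + t) (fun s => (-1) * g s) / ((h *: 1 + t) - t) <= - g t + e.
    apply: oriented_integral_le => //; first exact: continuous_integrable.
    by move=> s /gd; rewrite ler_norml; lra.
  rewrite oriented_integralZ in lo; last exact: continuous_integrable.
  rewrite -mulrA mulN1r in lo.
  have E : h *: 1 + t - t = h by rewrite [h *: 1]mulr1 addrK.
  rewrite E in up lo *.
  rewrite [_ *: _]mulrC ler_norml; move: up lo; set q := (_ / _); lra.
split; first by apply/cvg_ex; exists (g t).
exact: cvg_lim D.
Unshelve. all: by end_near. Qed.

Lemma mean_value (f f' : R -> R) (a b : R) :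
  (forall x : R, is_derive x (1 : R) f (f' x)) ->
  exists2 c, between a b c & f b - f a = f' c * (b - a).
Proof.
move=> df.
have H x y : x <= y -> exists2 c, x <= c <= y & f y - f x = f' c * (y - x).
  move=> xy; have cf : {within `[x, y], continuous f}.
    apply: continuous_subspaceT => z.
    by apply: differentiable_continuous; apply/derivable1_diffP; case: (df z).
  have [c] := @MVT_segment R f f' x y xy (fun z _ => df z) cf.
  by rewrite in_itv /=; exists c.
rewrite /between; have [ab|/ltW ba] := leP a b; first exact: H.
have [c cab E] := H _ _ ba; exists c => //.
by rewrite -opprB E -mulrN opprB.
Qed.

Lemma derive0_eq (f : R -> R) : (forall x : R, is_derive x (1 : R) f 0) -> forall a b, f b = f a.
Proof.
move=> df a b; have [c _] := @mean_value f (fun=> 0) a b df.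
by rewrite mul0r => /eqP; rewrite subr_eq0 => /eqP.
Qed.

Lemma is_derive_shift (g : R -> R) (c t l : R) : is_derive (t - c) (1 : R) g l ->
  is_derive t (1 : R) (fun s => g (s - c)) l.
Proof.
move=> dg; have ds : is_derive t (1 : R) (fun s : R => s - c) 1.
  by apply: is_derive_eq; rewrite subr0.
have := @is_derive1_comp R g (fun s => s - c) t _ _ dg ds.
by rewrite mulr1.
Qed.

Lemma is_derive_rescale (g : R -> R) (k t l : R) : is_derive (k * t) (1 : R) g l ->
  is_derive t (1 : R) (fun s => g (k * s)) (l * k).
Proof.
move=> dg; have ds : is_derive t (1 : R) (fun s : R => k * s) k.
  by apply: is_derive_eq; rewrite /GRing.scale /= mulr1.
exact: (@is_derive1_comp R g (fun s => k * s) t _ _ dg ds).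
Qed.

Lemma oriented_integral_shift (g : R -> R) (c t : R) : continuous g ->
  oint 0 (t - c) g = oint c t (fun s => g (s - c)).
Proof.
move=> cg; have cs : continuous (fun s => g (s - c)).
  move=> s; apply: continuous_comp; last exact: cg.
  by apply: cvgB; [exact: cvg_id | exact: cvg_cst].
pose D s := oint 0 (s - c) g - oint c s (fun s => g (s - c)).
suff E : D t = D c.
  by move: E; rewrite /D subrr !oriented_integral_same // subrr => /eqP; rewrite subr_eq0 => /eqP.
apply: derive0_eq => s.
have h1 : is_derive s (1 : R) (fun s => oint 0 (s - c) g) (g (s - c)).
  exact: (@is_derive_shift (fun s => oint 0 s g) c s _ (oriented_integral_derive 0 _ cg)).
have h2 : is_derive s (1 : R) _ (g (s - c)) := oriented_integral_derive c s cs.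
by apply: is_derive_eq; rewrite subrr.
Qed.

Lemma linear_planar_flow (al be : R) (a b : R -> R) :
  (forall t : R, is_derive t (1 : R) a (al * a t - be * b t)) ->
  (forall t : R, is_derive t (1 : R) b (be * a t + al * b t)) ->
  forall t,
  a t = expR (al * t) * (cos (be * t) * a 0 - sin (be * t) * b 0) /\
  b t = expR (al * t) * (cos (be * t) * b 0 + sin (be * t) * a 0).
Proof.
move=> da db t.
have dE (s : R) : is_derive s (1 : R) (fun s => expR ((- al) * s)) (expR ((- al) * s) * (- al)).
  exact: is_derive_rescale.
have dC (s : R) : is_derive s (1 : R) (fun s => cos (be * s)) (- sin (be * s) * be).
  exact: is_derive_rescale.
have dS (s : R) : is_derive s (1 : R) (fun s => sin (be * s)) (cos (be * s) * be).
  exact: is_derive_rescale.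
(* the real and imaginary parts of exp (- (al + i be) s) * (a s + i b s) *)
pose p s := expR ((- al) * s) * (cos (be * s) * a s + sin (be * s) * b s).
pose q s := expR ((- al) * s) * (cos (be * s) * b s - sin (be * s) * a s).
have dp (s : R) : is_derive s (1 : R) p 0.
  by apply: is_derive_eq; rewrite /GRing.scale /=; ring.
have dq (s : R) : is_derive s (1 : R) q 0.
  by apply: is_derive_eq; rewrite /GRing.scale /=; ring.
have := derive0_eq dp 0 t; have := derive0_eq dq 0 t.
rewrite /p /q !mulr0 expR0 cos0 sin0 !mul0r !mul1r addr0 subr0 => <- <-.
have e1 : expR (al * t) * expR ((- al) * t) = 1.
  by rewrite -expRD mulNr subrr expR0.
have cs : cos (be * t) ^+ 2 + sin (be * t) ^+ 2 = 1 by exact: cos2Dsin2.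
split.
  transitivity ((expR (al * t) * expR ((- al) * t)) *
      (cos (be * t) ^+ 2 + sin (be * t) ^+ 2) * a t); last by ring.
  by rewrite e1 cs !mul1r.
transitivity ((expR (al * t) * expR ((- al) * t)) *
    (cos (be * t) ^+ 2 + sin (be * t) ^+ 2) * b t); last by ring.
by rewrite e1 cs !mul1r.
Qed.

End ftc.

(** * Weighted estimates and geometric convergence *)

Section weighted_estimates.
Context (R : realType).
Local Notation oint := (@oriented_integral R).
Local Notation half := (2^-1 : R).

(** An even function, so that positive and negative times are treated together;
    unlike exp (K |t|) it is smooth at 0. *)
Definition weight (K t : R) := expR (K * t) + expR (- (K * t)).

Lemma weight_ge1 K t : 1 <= weight K t.
Proof.
rewrite /weight; have [h|h] := leP 0 (K * t).
  have : 1 <= expR (K * t) by rewrite -expR0 ler_expR.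
  by have := expR_ge0 (- (K * t)); lra.
have : 1 <= expR (- (K * t)) by rewrite -expR0 ler_expR; lra.
by have := expR_ge0 (K * t); lra.
Qed.

Lemma weight_le (K t T : R) : 0 <= K -> `|t| <= T ->
  weight K t <= 2 * expR (K * T).
Proof.
move=> K0 tT; rewrite /weight mulr_natl mulr2n lerD // ler_expR.
  by rewrite ler_wpM2l // (le_trans (ler_norm _) tT).
by rewrite -mulrN ler_wpM2l // (le_trans (ler_norm _)) // normrN.
Qed.

(** Integration from 0 gains the factor 1 / K on functions dominated by the
    weight, because the weight is, up to that factor, the derivative of the odd
    function S of the proof, and |S| is at most the weight. The comparison of
    the integral with C / K * S is made through the sign of derivatives, which
    covers both signs of t. *)
Lemma oriented_integral_weight (g : R -> R) (C K T t : R) : 0 < K -> 0 <= C ->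
  continuous g -> `|t| <= T ->
  (forall s, `|s| <= T -> `|g s| <= C * weight K s) ->
  `|oint 0 t g| <= C / K * weight K t.
Proof.
move=> K0 C0 cg tT gC.
pose S s := expR (K * s) - expR (- (K * s)).
have dS (s : R) : is_derive s (1 : R) S (K * weight K s).
  rewrite /S /weight.
  apply: is_derive_eq.
  rewrite /GRing.scale /=; ring.
have M s : `|S s| <= weight K s.
  rewrite /S /weight ler_norml; have := expR_ge0 (K * s).
  by have := expR_ge0 (- (K * s)); lra.
have dG (s : R) : is_derive s (1 : R) (fun s => oint 0 s g) (g s) :=
  oriented_integral_derive 0 s cg.
have CK : 0 <= C / K by rewrite divr_ge0 // ltW.
have o0 : oint 0 0 g = 0 by exact: oriented_integral_same.
have S0 : S 0 = 0 by rewrite /S mulr0 oppr0 subrr.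
have d1 (s : R) : is_derive s (1 : R) (fun s => C / K * S s - oint 0 s g) (C * weight K s - g s).
  apply: is_derive_eq; rewrite /GRing.scale /=; field.
  exact: lt0r_neq0.
have d2 (s : R) : is_derive s (1 : R) (fun s => C / K * S s + oint 0 s g) (C * weight K s + g s).
  apply: is_derive_eq; rewrite /GRing.scale /=; field.
  exact: lt0r_neq0.
have [c ct] := mean_value 0 t d1.
have [c' ct'] := mean_value 0 t d2.
rewrite S0 o0 mulr0 subr0 addr0 !subr0.
have bt x : between 0 t x -> - (C * weight K x) <= g x <= C * weight K x.
  move=> xt; rewrite -ler_norml; apply: gC; apply: le_trans tT.
  move: xt; rewrite /between ler_norml.
  by case: (leP 0 t) => th; case: (ger0P t) => hh; lra.
have := bt _ ct; have := bt _ ct'; set a := C * _; set b := C * _.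
move=> ha hb E' E.
suff : `|oint 0 t g| <= C / K * `|S t|.
  by move=> H; apply: le_trans H _; rewrite ler_wpM2l.
have -> : C / K * `|S t| = `|C / K * S t| by rewrite normrM (ger0_norm CK).
have [t0|t0] := leP 0 t.
  have : 0 <= (b - g c) * t by rewrite mulr_ge0//; lra.
  have : 0 <= (a + g c') * t by rewrite mulr_ge0//; lra.
  move=> h1 h2; rewrite ler_norml; move: (ler_norm (C / K * S t)); lra.
have : (b - g c) * t <= 0 by rewrite mulr_ge0_le0//; lra.
have : (a + g c') * t <= 0 by rewrite mulr_ge0_le0//; lra.
move=> h1 h2; rewrite ler_norml; move: (ler_norm (- (C / K * S t))); rewrite normrN; lra.
Qed.

Lemma half_pow_ge0 n : 0 <= half ^+ n.
Proof. by rewrite exprn_ge0 // invr_ge0. Qed.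

Lemma half_pow_small (C e : R) : 0 < e -> exists n, C * half ^+ n < e.
Proof.
move=> e0; have h1 : `|half| < 1 by rewrite ger0_norm ?invr_ge0 // invf_lt1 // ltr1n.
have /cvgrPdist_lt/(_ e e0) [N _ HN] := cvg_geometric C h1.
exists N; have := HN N (leqnn N); rewrite /= sub0r normrN /geometric.
exact/le_lt_trans/ler_norm.
Qed.

Lemma le_half_pow (a b C : R) : (forall n, a <= b + C * half ^+ n) -> a <= b.
Proof.
move=> H; apply/ler_addgt0Pr => e e0; have [n Hn] := half_pow_small C e0.
by apply: le_trans (H n) _; rewrite lerD2l ltW.
Qed.

(** The intervals centred at u n of radius 2 C / 2 ^ n are nested, which gives the
    limit together with the rate of convergence. *)
Lemma geometric_cauchy (u : nat -> R) (C : R) : 0 <= C ->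
  (forall n, `|u n.+1 - u n| <= C * half ^+ n) ->
  forall n, `|u n - lim (u @ \oo)| <= 2 * C * half ^+ n.
Proof.
move=> C0 du; pose e n := 2 * C * half ^+ n.
have e0 n : 0 <= e n by rewrite !mulr_ge0 // half_pow_ge0.
have eS n : e n.+1 = e n - C * half ^+ n.
  by rewrite /e exprS; set h := half ^+ n; field.
have mono n k : u n - e n <= u (n + k)%N - e (n + k)%N /\
    u (n + k)%N + e (n + k)%N <= u n + e n.
  elim: k => [|k [IH1 IH2]]; first by rewrite addn0.
  rewrite addnS eS; have := du (n + k)%N; rewrite ler_norml.
  by move: IH1 IH2; lra.
have cross n k : u n - e n <= u k + e k.
  have [nk|/ltnW kn] := leqP n k.
    have [] := mono n (k - n)%N; rewrite subnKC // => h _; have := e0 k; lra.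
  have [] := mono k (n - k)%N; rewrite subnKC // => _ h; have := e0 n; lra.
pose l := sup (range (fun n => u n - e n)).
have hs : has_sup (range (fun n => u n - e n)).
  split; first by exists (u 0%N - e 0%N), 0%N.
  by exists (u 0%N + e 0%N) => _ [n _ <-]; exact: cross.
have ul n : `|u n - l| <= e n.
  have h1 : u n - e n <= l by apply: (sup_upper_bound hs); exists n.
  have h2 : l <= u n + e n.
    apply: ge_sup; first by case: hs.
    by move=> _ [k _ <-]; exact: cross.
  by rewrite ler_norml; lra.
suff -> : lim (u @ \oo) = l by [].
apply: cvg_lim => //; apply/cvgrPdist_lt => eps eps0.
have [N HN] := half_pow_small (2 * C) eps0.
exists N => // n /= Nn; rewrite distrC; apply: le_lt_trans (ul n) _.
apply: le_lt_trans HN; rewrite /e ler_wpM2l ?mulr_ge0 //.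
by rewrite ler_wiXn2l ?invr_ge0 // invf_le1 // ler1n.
Qed.

End weighted_estimates.

(** * Row vectors *)

Section row_norm.
Context (R : realType) (d : nat).
Implicit Types x y : 'rV[R]_d.

Lemma coord_le_norm x i : `|x 0 i| <= `|x|.
Proof.
rewrite [leRHS]/Num.Def.normr /= mx_normrE.
by apply/bigmax_geP; right; exists (0, i).
Qed.

Lemma coordB_le_norm x y i :
  `|x 0 i - y 0 i| <= `|x - y|.
Proof. by have := coord_le_norm (x - y) i; rewrite !mxE. Qed.

Lemma row_norm_le x c : 0 <= c -> (forall i, `|x 0 i| <= c) -> `|x| <= c.
Proof.
move=> c0 xc; rewrite [leLHS]/Num.Def.normr /= mx_normrE bigmax_le //.
by move=> [i j] _ /=; rewrite ord1.
Qed.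

Lemma row_continuous (y : R -> 'rV[R]_d) :
  (forall i, continuous (fun t => y t 0 i)) -> continuous y.
Proof.
move=> cy t; apply/cvgrPdist_le => e e0; near=> s.
apply: row_norm_le; first exact: ltW.
move=> i; rewrite !mxE; move: i; near: s; apply: filter_forall => i.
have /cvgrPdist_le/(_ e e0) := cy i t; by [].
Unshelve. all: by end_near. Qed.

End row_norm.

Lemma near_lipschitz_cvg (R : realType) (V W : normedModType R) (G : V -> W)
    (x : V) (L : R) :
  (forall y, `|x - y| <= 1 -> `|G x - G y| <= L * `|x - y|) -> G y @[y --> x] --> G x.
Proof.
move=> GL; pose L' := `|L| + 1.
have L'0 : 0 < L' by rewrite ltr_wpDl.
apply/cvgrPdist_lt => e e0; near=> y.
have yx : `|x - y| <= 1 by near: y; apply: cvgr_dist_le => //; exact: cvg_id.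
have ye : `|x - y| < e / L'.
  by near: y; apply: cvgr_dist_lt; [exact: cvg_id | exact: divr_gt0].
apply: le_lt_trans (GL y yx) _; apply: (@le_lt_trans _ _ (L' * `|x - y|)).
  by rewrite ler_wpM2r // /L'; have := ler_norm L; lra.
by rewrite mulrC -ltr_pdivlMr.
Unshelve. all: by end_near. Qed.

(** * Picard iteration for a locally Lipschitz field of linear growth *)

Section picard.
Context (R : realType) (d : nat) (F : 'rV[R]_d -> 'rV[R]_d) (m : R).
Context (m_gt0 : 0 < m) (F_growth : forall x, `|F x| <= m * (1 + `|x|)).
Context (F_lip : forall r : R, exists2 L : R, 0 < L &
  forall x y, `|x| <= r -> `|y| <= r -> `|F x - F y| <= L * `|x - y|).
Local Notation oint := (@oriented_integral R).
Local Notation half := (2^-1 : R).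

Lemma field_continuous : continuous F.
Proof.
move=> x; have [L L0 HL] := F_lip (`|x| + 1).
apply: (@near_lipschitz_cvg _ _ _ F x L) => y xy.
apply: HL; first by rewrite lerDl.
by rewrite -[y](subrKC x) (le_trans (ler_normD _ _)) // lerD2l distrC.
Qed.

Lemma field_coord_continuous (y : R -> 'rV[R]_d) i :
  continuous y -> continuous (fun s => F (y s) 0 i).
Proof.
move=> cy t; apply/cvgrPdist_le => e e0; near=> s.
have : `|F (y t) - F (y s)| <= e.
  near: s; apply: cvgr_dist_le => //.
  by apply: continuous_comp; [exact: cy | exact: field_continuous].
by apply: le_trans; have := coord_le_norm (F (y t) - F (y s)) i; rewrite !mxE.
Unshelve. all: by end_near. Qed.

Fixpoint picard (x : 'rV[R]_d) (n : nat) : R -> 'rV[R]_d :=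
  if n is n'.+1 then
    fun t => \row_i (x 0 i + oint 0 t (fun s => F (picard x n' s) 0 i))
  else fun=> x.

Lemma picard_continuous x n : continuous (picard x n).
Proof.
elim: n => [|n IH]; first exact: cst_continuous.
apply: row_continuous => i t /=.
under eq_fun do rewrite mxE.
apply: cvgD; first exact: cvg_cst.
have := oriented_integral_derive 0 t (@field_coord_continuous _ i IH).
by case=> /derivable1_diffP /differentiable_continuous.
Qed.

Lemma picard_field_continuous x n i : continuous (fun s => F (picard x n s) 0 i).
Proof. exact/field_coord_continuous/picard_continuous. Qed.

(** The multiple 2 |x| + 1 of the weight is stable under the iteration: for
    K = 2 m the integral of m * (1 + |y|) is at most half of
    1 + (2 |x| + 1) times the weight, to which |x| is added. *)
Lemma picard_growth x n t :
  `|picard x n t| <= (2 * `|x| + 1) * weight (2 * m) t.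
Proof.
elim: n t => [|n IH] t /=.
  have := weight_ge1 (2 * m) t; have := normr_ge0 x; set w := weight _ _.
  by set a := `|x| => a0 w1; nra.
have w1 := weight_ge1 (2 * m) t; have x0 := normr_ge0 x.
apply: row_norm_le; first by rewrite mulr_ge0 //; lra.
move=> i; rewrite mxE; apply: le_trans (ler_normD _ _) _.
have m2 : 0 < 2 * m by rewrite mulr_gt0.
have C0 : 0 <= m * (2 * `|x| + 2) by rewrite mulr_ge0 ?ltW //; lra.
have := oriented_integral_weight m2 C0 (@picard_field_continuous x n i) (lexx `|t|).
move=> /(_ _)/wrap[s st|].
  apply: le_trans (coord_le_norm _ i) _; apply: le_trans (F_growth _) _.
  rewrite -mulrA ler_pM2l //; have := weight_ge1 (2 * m) s; have := IH s.
  by lra.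
have -> : m * (2 * `|x| + 2) / (2 * m) = `|x| + 1 by field; exact: lt0r_neq0.
by have := coord_le_norm x i; nra.
Qed.

(** With a weight of rate 2 L the integral operator halves weighted distances, as
    long as both curves stay in a ball where F is L-Lipschitz. *)
Lemma integral_field_contraction (y z : R -> 'rV[R]_d) (L r C T t : R) i :
  0 < L -> 0 <= C -> continuous y -> continuous z ->
  (forall x x', `|x| <= r -> `|x'| <= r -> `|F x - F x'| <= L * `|x - x'|) ->
  (forall s, `|s| <= T -> `|y s| <= r /\ `|z s| <= r) ->
  (forall s, `|s| <= T -> `|y s - z s| <= C * weight (2 * L) s) ->
  `|t| <= T ->
  `|oint 0 t (fun s => F (y s) 0 i) - oint 0 t (fun s => F (z s) 0 i)|
    <= C / 2 * weight (2 * L) t.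
Proof.
move=> L0 C0 cy cz HL yzr yz tT.
have cy' := @field_coord_continuous _ i cy; have cz' := @field_coord_continuous _ i cz.
rewrite oriented_integralB //.
have L2 : 0 < 2 * L by rewrite mulr_gt0.
have C0' : 0 <= L * C by rewrite mulr_ge0 // ltW.
have -> : C / 2 = L * C / (2 * L) by field; exact: lt0r_neq0.
apply: (oriented_integral_weight L2 C0' _ tT).
  by move=> s; apply: cvgB; [exact: cy'|exact: cz'].
move=> s sT; have := coord_le_norm (F (y s) - F (z s)) i; rewrite !mxE.
move/le_trans; apply; have [yr zr] := yzr s sT.
by apply: le_trans (HL _ _ yr zr) _; rewrite -mulrA ler_pM2l // yz.
Qed.

Definition solution x t := \row_i lim ((picard x n t 0 i) @[n --> \oo]).

Definition radius (r T : R) := (2 * r + 1) * (2 * expR (2 * m * T)).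

Lemma picard_radius r T x n t : `|x| <= r -> `|t| <= T ->
  `|picard x n t| <= radius r T.
Proof.
move=> xr tT; apply: le_trans (picard_growth x n t) _.
have m2 : 0 <= 2 * m by rewrite mulr_ge0 // ltW.
have := weight_le m2 tT; have := weight_ge1 (2 * m) t; have := normr_ge0 x.
rewrite /radius => ? ? ?.
by apply: ler_pM; lra.
Qed.

Lemma radius_ge0 r T : 0 <= r -> 0 <= radius r T.
Proof. by move=> r0; rewrite /radius !mulr_ge0 ?expR_ge0 //; lra. Qed.

(** Uniformity in x and t is what makes the limit continuous in time and lets it
    pass through F in the integral equation. *)
Lemma picard_cvg r T : 0 <= r -> exists2 C : R, 0 <= C &
  forall x t n, `|x| <= r -> `|t| <= T ->
    `|picard x n t - solution x t| <= C * half ^+ n.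
Proof.
move=> r0; have [L L0 HL] := F_lip (radius r T).
have q0 : 0 <= 2 * radius r T by apply: mulr_ge0 => //; exact: radius_ge0.
have qn n : 0 <= 2 * radius r T * half ^+ n.
  by apply: mulr_ge0 => //; exact: half_pow_ge0.
have step x n t : `|x| <= r -> `|t| <= T ->
    `|picard x n.+1 t - picard x n t| <= 2 * radius r T * half ^+ n * weight (2 * L) t.
  move=> xr; elim: n t => [|n IH] t tT.
    rewrite expr0 mulr1; apply: le_trans (ler_normB _ _) _.
    have := picard_radius 1 xr tT; have := picard_radius 0 xr tT.
    have := weight_ge1 (2 * L) t; nra.
  have w1 := weight_ge1 (2 * L) t.
  apply: row_norm_le.
    by apply: mulr_ge0 => //; lra.
  move=> i; rewrite /= !mxE opprD addrACA subrr add0r.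
  have -> : 2 * radius r T * half ^+ n.+1 = 2 * radius r T * half ^+ n / 2.
    by rewrite exprS; field.
  apply: (integral_field_contraction i L0 (qn n) _ _ HL _ _ tT).
  - exact: (@picard_continuous x n.+1).
  - exact: (@picard_continuous x n).
  - by move=> s sT; split; [exact: (@picard_radius r T x n.+1) | exact: picard_radius].
  - by move=> s sT; apply: IH.
pose C := 2 * radius r T * (2 * expR (2 * L * T)).
have C0 : 0 <= C by apply: mulr_ge0 => //; rewrite mulr_ge0 ?expR_ge0.
(* the factor 2 is the sum of the geometric series of the steps *)
exists (2 * C) => [|x t n xr tT]; first by rewrite mulr_ge0.
apply: row_norm_le; first by apply: mulr_ge0; [exact: mulr_ge0|exact: half_pow_ge0].
move=> i; rewrite !mxE; apply: geometric_cauchy => // k.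
have := coord_le_norm (picard x k.+1 t - picard x k t) i; rewrite !mxE.
move/le_trans; apply; apply: le_trans (step x k t xr tT) _.
rewrite /C [leRHS]mulrAC; apply: ler_wpM2l; first exact: qn.
by rewrite weight_le // mulr_ge0 // ltW.
Qed.

Lemma solution_radius r T x t : `|x| <= r -> `|t| <= T ->
  `|solution x t| <= radius r T.
Proof.
move=> xr tT; have r0 : 0 <= r by apply: le_trans xr.
have [C C0 HC] := picard_cvg T r0.
apply: (@le_half_pow _ _ _ C) => n.
rewrite -[solution x t](subrKC (picard x n t)).
apply: le_trans (ler_normD _ _) _; rewrite lerD //; first exact: picard_radius.
by rewrite distrC HC.
Qed.

Lemma solution_continuous_time x : continuous (solution x).
Proof.
move=> t; apply/cvgrPdist_lt => e e0.
have [C C0 HC] := picard_cvg (`|t| + 1) (normr_ge0 x).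
have e3 : 0 < e / 3 by rewrite divr_gt0.
have [n Hn] := half_pow_small C e3.
near=> s.
have ts : `|t - s| < 1 by near: s; apply: cvgr_dist_lt => //; exact: cvg_id.
have pp : `|picard x n t - picard x n s| < e / 3.
  by near: s; apply: cvgr_dist_lt => //; exact: picard_continuous.
have h1 : `|picard x n t - solution x t| < e / 3.
  by apply: le_lt_trans Hn; apply: HC => //; rewrite lerDl.
have h2 : `|picard x n s - solution x s| < e / 3.
  apply: le_lt_trans Hn; apply: HC => //.
  rewrite -[s](subrKC t) (le_trans (ler_normD _ _)) // lerD2l.
  by rewrite distrC ltW.
have -> : solution x t - solution x s = (solution x t - picard x n t)
   + ((picard x n t - picard x n s) + (picard x n s - solution x s)).
  by rewrite !addrA !subrK.
apply: le_lt_trans (ler_normD _ _) _; rewrite distrC.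
have := ler_normD (picard x n t - picard x n s) (picard x n s - solution x s).
lra.
Unshelve. all: by end_near. Qed.

Lemma solution_integral x t i :
  solution x t 0 i = x 0 i + oint 0 t (fun s => F (solution x s) 0 i).
Proof.
have [C C0 HC] := picard_cvg `|t| (normr_ge0 x).
have [L L0 HL] := F_lip (radius `|x| `|t|).
set I := oint _ _ _.
suff : `|solution x t 0 i - (x 0 i + I)| <= 0.
  by rewrite normr_le0 subr_eq0 => /eqP.
pose W := weight (2 * L) t.
apply: (@le_half_pow _ _ _ (C + C / 2 * W)) => n; rewrite add0r.
have h1 : `|picard x n.+1 t 0 i - solution x t 0 i| <= C * half ^+ n.
  apply: le_trans (coordB_le_norm _ _ i) _; apply: le_trans (HC _ _ _ _ _) _ => //.
  rewrite ler_wpM2l // exprS; have := half_pow_ge0 R n; set h := half ^+ n; lra.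
have h2 : `|oint 0 t (fun s => F (picard x n s) 0 i) - I| <= C * half ^+ n / 2 * W.
  apply: (@integral_field_contraction _ _ L (radius `|x| `|t|) _ `|t|) => //.
  - by rewrite mulr_ge0 ?half_pow_ge0 //.
  - exact: picard_continuous.
  - exact: solution_continuous_time.
  - by move=> s st; split; [exact: picard_radius | exact: solution_radius].
  - move=> s st; apply: le_trans (HC _ _ _ _ st) _ => //.
    rewrite ler_peMr //; last exact: weight_ge1.
    by rewrite mulr_ge0 ?half_pow_ge0 //.
have E : picard x n.+1 t 0 i = x 0 i + oint 0 t (fun s => F (picard x n s) 0 i).
  by rewrite /= mxE.
rewrite E in h1; move: h1 h2; rewrite !ler_norml.
set a := oint _ _ _; set h := half ^+ n; lra.
Qed.

(** The bound 2 |y - z| times the weight passes from one iterate to the next: the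
    initial difference |y - z| is added to half of it. It therefore holds for
    the limit, so that solutions depend in a Lipschitz way on their initial
    point on bounded sets. *)
Lemma solution_continuous_initial t : continuous (solution^~ t).
Proof.
move=> x; pose r := `|x| + 1; have r0 : 0 <= r by rewrite /r addr_ge0.
have [L L0 HL] := F_lip (radius r `|t|).
have [C C0 HC] := picard_cvg `|t| r0.
have dep y z n s : `|y| <= r -> `|z| <= r -> `|s| <= `|t| ->
    `|picard y n s - picard z n s| <= 2 * `|y - z| * weight (2 * L) s.
  move=> yr zr; elim: n s => [|n IH] s st.
    have := weight_ge1 (2 * L) s; have := normr_ge0 (y - z); rewrite /=; nra.
  have w1 := weight_ge1 (2 * L) s; have yz0 := normr_ge0 (y - z).
  apply: row_norm_le; first by rewrite !mulr_ge0 //; lra.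
  move=> i; rewrite /= !mxE opprD addrACA; apply: le_trans (ler_normD _ _) _.
  have := coord_le_norm (y - z) i; rewrite !mxE => yzi.
  have D0 : 0 <= 2 * `|y - z| by rewrite mulr_ge0.
  have := @integral_field_contraction (picard y n) (picard z n) L (radius r `|t|)
    (2 * `|y - z|) `|t| s i L0 D0 (@picard_continuous y n) (@picard_continuous z n) HL.
  move=> /(_ _ IH st)/wrap[q qt|].
    by split; exact: picard_radius.
  by move: yzi; set a := `|_ - _|; set b := `|oint _ _ _ - _|; nra.
have dep' y z : `|y| <= r -> `|z| <= r ->
    `|solution y t - solution z t| <= 2 * `|y - z| * weight (2 * L) t.
  move=> yr zr; apply: (@le_half_pow _ _ _ (2 * C)) => n.
  have -> : solution y t - solution z t = (solution y t - picard y n t)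
   + ((picard y n t - picard z n t) + (picard z n t - solution z t)).
    by rewrite !addrA !subrK.
  apply: le_trans (ler_normD _ _) _; rewrite [`|_ - picard y n t|]distrC.
  have := ler_normD (picard y n t - picard z n t) (picard z n t - solution z t).
  have := HC y t n yr (lexx _); have := HC z t n zr (lexx _).
  by have := dep y z n t yr zr (lexx _); set h := half ^+ n; lra.
apply: (@near_lipschitz_cvg _ _ _ (solution^~ t) x (2 * weight (2 * L) t)) => y xy.
rewrite [leRHS]mulrAC; apply: dep'; first by rewrite /r lerDl.
by rewrite -[y](subrKC x) (le_trans (ler_normD _ _)) // lerD2l distrC.
Qed.

End picard.

(** * Observables: complex values and differentials *)

Lemma ReM (R : realType) (z w : Cplx R) : complex.Re (z * w) =
  complex.Re z * complex.Re w - complex.Im z * complex.Im w.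
Proof. by case: z; case: w. Qed.

Lemma ImM (R : realType) (z w : Cplx R) : complex.Im (z * w) =
  complex.Re z * complex.Im w + complex.Im z * complex.Re w.
Proof. by case: z; case: w. Qed.

Lemma Re_sum (R : realType) (I : Type) (r : seq I) (z : I -> Cplx R) :
  complex.Re (\sum_(i <- r) z i) = \sum_(i <- r) complex.Re (z i).
Proof. by apply: (big_morph (@complex.Re R)) => // -[a b] [c e]. Qed.

Lemma Im_sum (R : realType) (I : Type) (r : seq I) (z : I -> Cplx R) :
  complex.Im (\sum_(i <- r) z i) = \sum_(i <- r) complex.Im (z i).
Proof. by apply: (big_morph (@complex.Im R)) => // -[a b] [c e]. Qed.

Lemma Re_div_real (R : realType) (z : Cplx R) (r : R) :
  complex.Re (z / r%:C) = complex.Re z / r.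
Proof. by rewrite -fmorphV ReM /= mulr0 subr0. Qed.

Lemma Im_div_real (R : realType) (z : Cplx R) (r : R) :
  complex.Im (z / r%:C) = complex.Im z / r.
Proof. by rewrite -fmorphV ImM /= mulr0 add0r. Qed.

Lemma Re_affine_real (R : realType) (z : Cplx R) (r : R) :
  complex.Re (z * r%:C + 1) = complex.Re z * r + 1.
Proof. by case: z => a b; rewrite /= mulr0 subr0. Qed.

Lemma Im_affine_real (R : realType) (z : Cplx R) (r : R) :
  complex.Im (z * r%:C + 1) = complex.Im z * r.
Proof. by case: z => a b; rewrite /= mulr0 add0r addr0. Qed.

Lemma Cplx_cvg (R : realType) (T : Type) (F : set_system T) (FF : Filter F)
    (z : T -> Cplx R) (l : Cplx R) :
  complex.Re (z x) @[x --> F] --> complex.Re l ->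
  complex.Im (z x) @[x --> F] --> complex.Im l -> z x @[x --> F] --> l.
Proof.
move=> zr zi; apply/cvgrPdist_lt => e e0.
have [e' e'0 ee] : exists2 e' : R, 0 < e' & e = e'%:C.
  by case: e e0 => a b; rewrite ltcE /= => /andP[/eqP -> a0]; exists a.
have e2 : 0 < e' / 2 by rewrite divr_gt0.
near=> x.
have h1 : `|complex.Re l - complex.Re (z x)| < e' / 2.
  by near: x; exact: cvgr_dist_lt.
have h2 : `|complex.Im l - complex.Im (z x)| < e' / 2.
  by near: x; exact: cvgr_dist_lt.
rewrite ee; have -> : `|l - z x| = (Num.sqrt ((complex.Re (l - z x)) ^+ 2 +
    (complex.Im (l - z x)) ^+ 2))%:C by exact: normc_def.
have -> : complex.Re (l - z x) = complex.Re l - complex.Re (z x).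
  by case: (l) => ? ?; case: (z x).
have -> : complex.Im (l - z x) = complex.Im l - complex.Im (z x).
  by case: (l) => ? ?; case: (z x).
rewrite ltcR -(ger0_norm (ltW e'0)) -sqrtr_sqr ltr_sqrt ?exprn_gt0 //.
move: h1 h2; rewrite !ltr_norml; set p := _ - _; set q := _ - _.
move=> /andP[? ?] /andP[? ?]; nra.
Unshelve. all: by end_near. Qed.

Local Notation slope psi x v := (\sum_i v 0 i * 'D_(delta_mx 0 i) psi x).

Section differentials.
Context (R : realType) (d : nat).
Implicit Types (psi : 'rV[R]_d -> R) (phi : 'rV[R]_d -> Cplx R).

Lemma diff_row_partial (psi : 'rV[R]_d -> R) (x v : 'rV[R]_d) :
  differentiable psi x ->
  'd psi x v = slope psi x v.
Proof.
move=> dpsi; rewrite {1}(row_sum_delta v) linear_sum.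
by apply: eq_bigr => i _; rewrite linearZ deriveE.
Qed.

Lemma is_derive_along_curve (psi : 'rV[R]_d -> R) (y : R -> 'rV[R]_d) (t : R)
    (v : 'rV[R]_d) : differentiable psi (y t) ->
  (forall i, is_derive t (1 : R) (fun s => y s 0 i) (v 0 i)) ->
  is_derive t (1 : R) (psi \o y) (slope psi (y t) v).
Proof.
move=> dpsi dy.
have dry : derivable y t 1 by apply/derivable_mxP => i j; rewrite ord1; case: (dy j).
have diffy : differentiable y t by apply/derivable1_diffP.
have Dy : 'D_1 y t = v.
  rewrite derive_mx //; apply/matrixP => i j; rewrite mxE ord1.
  exact: derive_val.
split; first by apply/derivable1_diffP; exact: differentiable_comp.
rewrite deriveE; last exact: differentiable_comp.
have dy1 : 'd y t 1 = v by rewrite -deriveE.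
by rewrite diff_comp //= dy1 diff_row_partial.
Qed.

Lemma Re_grad_dot phi v x :
  complex.Re (grad_dot phi v x) =
  slope (re_part phi) x (v x).
Proof.
rewrite /grad_dot Re_sum; apply: eq_bigr => i _ /=.
by rewrite mulr0 subr0 mulrC.
Qed.

Lemma Im_grad_dot phi v x :
  complex.Im (grad_dot phi v x) =
  slope (im_part phi) x (v x).
Proof.
rewrite /grad_dot Im_sum; apply: eq_bigr => i _ /=.
by rewrite mulr0 add0r mulrC.
Qed.

Lemma C1c_C0c phi : C1c phi -> C0c phi.
Proof.
move=> [dre dim _ cphi]; split => // x.
have hr := differentiable_continuous (dre x).
have hi := differentiable_continuous (dim x).
exact: (@Cplx_cvg R _ (nbhs x) _ phi (phi x) hr hi).
Qed.

End differentials.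

Lemma differentiable_expansion (R : realType) (V : normedModType R) (psi : V -> R)
    (x : V) (e : R) : differentiable psi x -> 0 < e ->
  exists2 del : R, 0 < del & forall y, `|y - x| < del ->
    `|psi y - psi x - 'd psi x (y - x)| <= e * `|y - x|.
Proof.
move=> dpsi e0.
have : \forall h \near (0 : V), `|psi (h + x) - psi x - 'd psi x h| <= e * `|h|.
  have /diff_locallyP [_ /eqaddoP /(_ e e0)] := dpsi.
  apply: filterS => h /=.
  have -> : psi (h + x) - psi x - 'd psi x h = psi (h + x) - (psi x + 'd psi x h).
    by move: ('d psi x h) => b; ring.
  by [].
move=> /nbhs_normP [del del0 H]; exists del => // y yx.
have := H (y - x); rewrite /ball_ /= sub0r normrN subrK; exact.
Unshelve. all: by end_near. Qed.

(** * Eigenfunctions along the flow of a constant control *)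

Section eigenflow.
Context (R : realType) (d : nat) (U : metricType R) (T : R).
Context (f : 'rV[R]_d * U -> 'rV[R]_d).
Context (f_growth : exists m : R, 0 < m /\
      forall (x : 'rV[R]_d) (u : U), `|f (x, u)| <= m * (1 + `|x|))
    (f_lip : forall K : set 'rV[R]_d, compact K ->
      exists l : R, 0 < l /\
        forall (x y : 'rV[R]_d) (u : U), K x -> K y ->
          `|f (x, u) - f (y, u)| <= l * `|x - y|).

Lemma lipschitz_on_balls (r : R) : exists2 L : R, 0 < L &
  forall x y u, `|x| <= r -> `|y| <= r -> `|f (x, u) - f (y, u)| <= L * `|x - y|.
Proof.
have cK : compact [set x : 'rV[R]_d | `|x| <= r].
  apply: bounded_closed_compact.
    by exists r; split; [exact: num_real | move=> s rs x /= /le_trans; apply; exact: ltW].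
  apply: (@closed_comp _ _ (fun x : 'rV[R]_d => `|x|) [set s | s <= r]).
    by move=> x _; exact: norm_continuous.
  exact: closed_le.
by have [L [L0 HL]] := f_lip cK; exists L => // x y u xr yr; exact: HL.
Qed.

Lemma constant_admissible (u : U) : admissible T (fun=> u).
Proof.
move=> B _; have [uB|uB] := pselect (B u).
  have -> : (fun=> u : U) @^-1` B = [set: R] by apply/seteqP; split.
  by rewrite setIT; exact: itv_completed.
have -> : (fun=> u : U) @^-1` B = (set0 : set R) by apply/seteqP; split.
by rewrite setI0; exact: measurable0.
Qed.

(** The field does not depend on time, so the flow map from tau to t only depends
    on t - tau. *)
Lemma autonomous_flow (u : U) : exists gam : R -> 'rV[R]_d -> 'rV[R]_d,
  [/\ controlled_flow f T (fun=> u) (fun tau t => gam (t - tau)),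
      forall x, gam 0 x = x &
      forall x t i, is_derive t (1 : R) (fun s => gam s x 0 i) (f (gam t x, u) 0 i)].
Proof.
have [m [m0 fm]] := f_growth.
pose F x := f (x, u).
have Fm x : `|F x| <= m * (1 + `|x|) by exact: fm.
have FL r : exists2 L : R, 0 < L &
    forall x y, `|x| <= r -> `|y| <= r -> `|F x - F y| <= L * `|x - y|.
  by have [L L0 HL] := lipschitz_on_balls r; exists L => // x y; exact: HL.
have cg x i : continuous (fun s => F (solution F x s) 0 i).
  exact/(field_coord_continuous FL)/(solution_continuous_time m0 Fm FL).
have sol0 x : solution F x 0 = x.
  apply/rowP => i; rewrite (solution_integral m0 Fm FL) oriented_integral_same ?addr0 //.
exists (fun t x => solution F x t); split => // [tau t _ _|x t i].
  split; first exact: (solution_continuous_initial m0 Fm FL).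
  move=> x i; have cs : continuous (fun s => F (solution F x (s - tau)) 0 i).
    move=> s; apply: (@continuous_comp _ _ _ (fun s => s - tau)
      (fun s => F (solution F x s) 0 i)); last exact: cg.
    by apply: cvgB; [exact: cvg_id | exact: cvg_cst].
  split; first exact: continuous_integrable.
  by rewrite (solution_integral m0 Fm FL) oriented_integral_shift.
have -> : (fun s => solution F x s 0 i) =
  (fun s => x 0 i + oriented_integral 0 s (fun s => F (solution F x s) 0 i)).
  by apply/funext => s; rewrite (solution_integral m0 Fm FL).
have h1 : is_derive t (1 : R) _ (F (solution F x t) 0 i) := oriented_integral_derive 0 t (cg x i).
rewrite -[X in is_derive _ _ _ X]add0r.
exact: (is_deriveD (is_derive_cst (x 0 i) t (1 : R)) h1).
Qed.

(** Along a trajectory, the real and imaginary parts of phi solve the linear planar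
    system given by the multiplication by lambda. *)
Lemma eigen_along_flow (u : U) (gam : R -> 'rV[R]_d -> 'rV[R]_d)
    (lambda : Cplx R) (phi : 'rV[R]_d -> Cplx R) (t : R) (x : 'rV[R]_d) :
  (forall x, differentiable (re_part phi) x) ->
  (forall x, differentiable (im_part phi) x) ->
  (forall x, gam 0 x = x) ->
  (forall x t i, is_derive t (1 : R) (fun s => gam s x 0 i) (f (gam t x, u) 0 i)) ->
  grad_dot phi (fun x => f (x, u)) = lambda *: phi ->
  phi (gam t x) = cexp (lambda * t%:C) * phi x.
Proof.
move=> dre dim gam0 dgam eig.
have E y : \sum_i (f (y, u)) 0 i * 'D_(delta_mx 0 i) (re_part phi) y =
     complex.Re lambda * re_part phi y - complex.Im lambda * im_part phi y /\
   \sum_i (f (y, u)) 0 i * 'D_(delta_mx 0 i) (im_part phi) y =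
     complex.Im lambda * re_part phi y + complex.Re lambda * im_part phi y.
  rewrite -(Re_grad_dot phi (fun x => f (x, u))) -(Im_grad_dot phi (fun x => f (x, u))).
  rewrite eig (_ : (lambda *: phi) y = lambda * phi y) // /re_part /im_part.
  case: lambda {eig} => al be; case: (phi y) => a b /=; split=> //.
  by rewrite addrC.
have da (s : R) := is_derive_along_curve (dre (gam s x)) (dgam x s).
have db (s : R) := is_derive_along_curve (dim (gam s x)) (dgam x s).
have [] := @linear_planar_flow R (complex.Re lambda) (complex.Im lambda)
  (fun s => re_part phi (gam s x)) (fun s => im_part phi (gam s x)) _ _ t.
- by move=> s; have [<- _] := E (gam s x); exact: da.
- by move=> s; have [_ <-] := E (gam s x); exact: db.
rewrite /re_part /im_part gam0 /cexp.
case: lambda {eig E} => al be; case: (phi x) => a b; case: (phi (gam t x)) => a' b' /=.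
rewrite !mulr0 !subr0 !add0r => -> ->.
set ex := expR _; set c := cos _; set si := sin _.
by apply/eqP; rewrite eq_complex /=; apply/andP; split; apply/eqP; ring.
Qed.

Lemma Liouville_eigenvector_Koopman (tau t : R) (lambda : Cplx R)
    (phi : 'rV[R]_d -> Cplx R) :
  eigenvector (@C1c R d) (Liouville f) lambda phi ->
  eigenvector (@C0c R d) (Koopman f T tau t)
    (cexp (lambda * (t - tau)%:C)) phi.
Proof.
move=> [phiC1 phi0 [u _ eig]]; split => //; first exact: C1c_C0c.
have [gam [flow gam0 dgam]] := autonomous_flow u.
exists (fun=> u), (fun tau t => gam (t - tau)); split => //.
  exact: constant_admissible.
apply/funext => x; case: phiC1 => dre dim _ _.
by rewrite /= (eigen_along_flow _ _ dre dim gam0 dgam eig).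
Qed.

End eigenflow.

(** * Realising a point of the hull of a compact convex family *)

(** U parametrises the family of functions G u on I, which is convex as a set of
    functions. The hypothesis on target is the separation form of being in the
    closed convex hull for the topology of pointwise convergence. *)
Section convex_realisation.
Context (R : realType) (U : topologicalType) (I : eqType) (G : U -> I -> R).
Context (target : I -> R).
Context (U_compact : compact [set: U]) (U_nonempty : [set: U] !=set0).
Context (G_cont : forall i, continuous (G^~ i)).
Context (G_convex : forall u v (th : R), 0 <= th <= 1 ->
  exists w, forall i, G w i = th * G u i + (1 - th) * G v i).
Context (target_in_hull : forall (l : seq I) (c : I -> R) (M : R),
  (forall u, \sum_(i <- l) c i * G u i <= M) ->
  \sum_(i <- l) c i * target i <= M).

(** Let w minimise the squared distance of G u to the target on l. The residual
    c = target - G w defines a linear form which, by minimality along segments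
    from w, is maximal at G w among all G u. The hypothesis then bounds its value
    at the target, which says that the sum of the squares of c is at most 0. *)
Lemma convex_realisation_finite (l : seq I) : exists u, {in l, forall i, G u i = target i}.
Proof.
pose q u := \sum_(i <- l) (target i - G u i) ^+ 2.
have cq : continuous q.
  move=> u; apply: cvg_big => [|i _]; first exact: add_continuous.
  have h : target i - G u' i @[u' --> u] --> target i - G u i.
    by apply: cvgB; [exact: cvg_cst | exact: G_cont].
  by rewrite expr2; under eq_fun do rewrite expr2; exact: (cvgM h h).
have cq' : {within [set: U], continuous q} by exact: continuous_subspaceT.
have [w _ wmin] := compact_EVT_min U_nonempty U_compact cq'.
have {}wmin u : q w <= q u by apply: wmin; rewrite inE.
pose c i := target i - G w i.
have var u : \sum_(i <- l) c i * (G u i - G w i) <= 0.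
  set S := \sum_(i <- l) _; pose S2 := \sum_(i <- l) (G u i - G w i) ^+ 2.
  have S20 : 0 <= S2 by apply: sumr_ge0 => i _; exact: sqr_ge0.
  have H th : 0 < th -> th <= 1 -> 2 * S <= th * S2.
    move=> th0 th1; have th01 : 0 <= th <= 1 by rewrite ltW.
    have [v Hv] := G_convex u w th01.
    have := wmin v.
    have -> : q v = q w - 2 * th * S + th ^+ 2 * S2.
      rewrite /q /S /S2 !big_distrr /= -sumrB -big_split /=.
      by apply: eq_bigr => i _; rewrite Hv /c; ring.
    move=> h; have : th * (2 * S) <= th * (th * S2) by lra.
    by rewrite ler_pM2l.
  rewrite leNgt; apply/negP => S0.
  (* th = S / (1 + S2) contradicts H if it is at most 1, and th = 1 otherwise *)
  have [/H h|h] := leP (S / (1 + S2)) 1.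
    have := h; rewrite divr_gt0 //; last lra.
    move=> /(_ isT); rewrite mulrAC ler_pdivlMr; last by lra.
    by move=> h'; nra.
  by have := H 1 ltr01 (lexx _); move: h; rewrite ltr_pdivlMr; lra.
have := @target_in_hull l c (\sum_(i <- l) c i * G w i).
move=> /(_ _)/wrap[u|].
  rewrite -subr_le0 -sumrB; apply: le_trans (var u).
  by apply: ler_sum => i _; rewrite mulrBr.
rewrite -subr_le0 -sumrB => h.
exists w => i il.
have : \sum_(i <- l) (c i) ^+ 2 == 0.
  rewrite eq_le; apply/andP; split; last by apply: sumr_ge0 => j _; exact: sqr_ge0.
  by apply: le_trans h; apply: ler_sum => j _; rewrite -mulrBr -expr2.
rewrite psumr_eq0; last by move=> j _; exact: sqr_ge0.
move=> /allP /(_ i il) /=; rewrite sqrf_eq0 subr_eq0 => /eqP.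
by [].
Qed.

(** The finite problems are solvable, so their solution sets generate a proper
    filter; a cluster point solves each equation because solution sets of single
    equations are closed. *)
Lemma convex_realisation : exists u, forall i, G u i = target i.
Proof.
pose B (l : seq I) := [set u | {in l, forall i, G u i = target i}].
pose F := filter_from [set: seq I] B.
have FF : ProperFilter F.
  apply: filter_from_proper.
    apply: filter_from_filter; first by exists [::].
    move=> l1 l2 _ _; exists (l1 ++ l2) => // u uB; split=> i il; apply: uB.
      by rewrite mem_cat il.
    by rewrite mem_cat il orbT.
  by move=> l _; exact: convex_realisation_finite.
have [|p [_ clp]] := U_compact FF; first by exists [::].
exists p => i.
have cl : closed [set u | G u i = target i].
  apply: (@closed_comp _ _ (G^~ i) [set target i]); last exact: closed_eq.
  by move=> u _; exact: G_cont.
apply: cl => A nA; apply: clp => //; exists [:: i] => // u uB.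
by apply: uB; rewrite mem_seq1.
Qed.

End convex_realisation.

(** * Short-time expansion along controlled trajectories *)

Section short_time.
Context (R : realType) (d : nat) (U : metricType R) (T : R).
Context (f : 'rV[R]_d * U -> 'rV[R]_d) (m : R) (m_gt0 : 0 < m).
Context (f_growth : forall (x : 'rV[R]_d) (u : U), `|f (x, u)| <= m * (1 + `|x|)).
Context (f_lip : forall r : R, exists2 L : R, 0 < L &
  forall x y u, `|x| <= r -> `|y| <= r -> `|f (x, u) - f (y, u)| <= L * `|x - y|).
Local Notation mu := (@completed_lebesgue_measure R).
Context (tau : R) (tauT : tau \in `[0, T]).

Lemma between_itv t s : t \in `[0, T] -> between tau t s -> s \in `[0, T].
Proof.
move: tauT; rewrite !in_itv /= /between => ? ?.
by case: (leP tau t) => ?; lra.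
Qed.

(** The bound is the same for all controls. The supremum S of |y| between tau and t
    is finite by integrability of the velocity, and then
    S <= |x| + m (1 + S) |t - tau| gives S <= 2 |x| + 1 for such short times. *)
Lemma flow_displacement (u : R -> U) (Phi : R -> R -> 'rV[R]_d -> 'rV[R]_d)
    (t : R) (x : 'rV[R]_d) : controlled_flow f T u Phi -> t \in `[0, T] ->
  `|t - tau| <= (2 * m)^-1 ->
  `|Phi tau t x - x| <= m * (2 + 2 * `|x|) * `|t - tau|.
Proof.
move=> flow tT small.
pose y s := Phi tau s x; pose h i s := f (y s, u s) 0 i.
have eqy s i : s \in `[0, T] -> y s 0 i - x 0 i = oriented_integral tau s (h i).
  by move=> sT; have [_ /(_ x i)[_ E]] := flow tau s tauT sT; rewrite /y E addrC addKr.
have hi s i : s \in `[0, T] ->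
    mu.-integrable `[Num.min tau s, Num.max tau s] (EFin \o h i).
  by move=> sT; have [_ /(_ x i)[]] := flow tau s tauT sT.
have [B HB] : exists B, forall s, between tau t s -> `|y s| <= B.
  have Bi i : exists B, forall s, between tau t s -> `|oriented_integral tau s (h i)| <= B.
    exact: oriented_integral_bounded (hi t i tT).
  have [b Hb] := choice Bi.
  exists (`|x| + \sum_i `|b i|) => s st.
  have b0 : 0 <= \sum_i `|b i| by apply: sumr_ge0.
  rewrite -[y s](subrKC x); apply: le_trans (ler_normD _ _) _; rewrite lerD2l.
  apply: row_norm_le => // i; rewrite !mxE eqy; last exact: between_itv st.
  rewrite (bigD1 i) //=; apply: le_trans (Hb i s st) _.
  apply: le_trans (ler_norm _) _; rewrite lerDl; exact: sumr_ge0.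
pose S := sup [set `|y s| | s in between tau t].
have hs : has_sup [set `|y s| | s in between tau t].
  split; first by exists `|y t|, t => //; exact: betweenr.
  by exists B => _ [s st <-]; exact: HB.
have yS s : between tau t s -> `|y s| <= S.
  by move=> st; apply: (sup_upper_bound hs); exists s.
have S0 : 0 <= S by apply: le_trans (yS t (betweenr _ _)).
have disp s : between tau t s -> `|y s - x| <= m * (1 + S) * `|s - tau|.
  move=> st; apply: row_norm_le.
    by apply: mulr_ge0 => //; apply: mulr_ge0; [exact: ltW | exact: addr_ge0].
  move=> i; rewrite !mxE eqy; last exact: between_itv st.
  apply: oriented_integral_norm_le; first exact/hi/(between_itv tT st).
  move=> s' ss'; apply: le_trans (coord_le_norm _ _) _.
  apply: le_trans (f_growth _ _) _; rewrite ler_pM2l // lerD2l.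
  exact/yS/(between_swap st ss').
have S2 : S <= 2 * `|x| + 1.
  suff : S <= `|x| + (1 + S) / 2 by lra.
  apply: ge_sup; first by case: hs.
  move=> _ [s st <-]; rewrite -[y s](subrKC x); apply: le_trans (ler_normD _ _) _.
  rewrite lerD2l; apply: le_trans (disp s st) _.
  have : `|s - tau| <= (2 * m)^-1 by apply: le_trans small; exact: between_norm.
  rewrite -[X in _ <= X -> _]mul1r ler_pdivlMr ?mulr_gt0 // => h1.
  have := normr_ge0 (s - tau); nra.
apply: le_trans (disp t (betweenr _ _)) _.
by apply: ler_wpM2r => //; apply: ler_wpM2l; [exact: ltW | lra].
Qed.

(** The auxiliary function k is grad psi (x) applied to the velocity of the
    trajectory that starts from x. With the gradient frozen at x, the integral of
    k is exactly the differential of psi at x applied to the displacement. The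
    time del is uniform over all controls and flows. *)
Lemma increment_expansion (psi : 'rV[R]_d -> R) (x : 'rV[R]_d) (e : R) :
  differentiable psi x -> 0 < e ->
  exists2 del : R, 0 < del &
    forall u Phi t, controlled_flow f T u Phi -> t \in `[0, T] -> t != tau ->
      `|t - tau| < del ->
      exists k : R -> R,
      [/\ mu.-integrable `[Num.min tau t, Num.max tau t] (EFin \o k),
         forall s, between tau t s -> `|k s - slope psi x (f (x, u s))| <= e &
         `|(psi (Phi tau t x) - psi x) / (t - tau) -
           oriented_integral tau t k / (t - tau)| <= e].
Proof.
move=> dpsi e0.
pose C := m * (2 + 2 * `|x|).
have C0 : 0 < C by rewrite mulr_gt0 //; have := normr_ge0 x; lra.
have [L L0 HL] := f_lip (2 * `|x| + 1).
pose A := \sum_i `|'D_(delta_mx 0 i) psi x|.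
have A0 : 0 <= A by apply: sumr_ge0.
have ddA (v : 'rV[R]_d) : `|slope psi x v| <= A * `|v|.
  rewrite mulr_suml; apply: le_trans (ler_norm_sum _ _ _) _.
  by apply: ler_sum => i _; rewrite normrM mulrC ler_wpM2l // coord_le_norm.
have [del1 del10 H1] := differentiable_expansion dpsi (divr_gt0 e0 C0).
pose K := A * L * C + 1.
have K0 : 0 < K by rewrite ltr_wpDl // !mulr_ge0 // ltW.
exists (Num.min (2 * m)^-1 (Num.min (del1 / C) (e / K))).
  by rewrite !lt_min invr_gt0 mulr_gt0 //= !divr_gt0.
move=> u Phi t flow tT tt; rewrite !lt_min => /andP[d1 /andP[d2 d3]].
pose y s := Phi tau s x; pose h i s := f (y s, u s) 0 i.
have hi i : mu.-integrable `[Num.min tau t, Num.max tau t] (EFin \o h i).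
  by have [_ /(_ x i)[]] := flow tau t tauT tT.
have disp s : between tau t s -> `|y s - x| <= C * `|s - tau|.
  move=> st; apply: flow_displacement; [exact: flow | exact: between_itv st|].
  by apply: le_trans (ltW d1); exact: between_norm.
have [Ek ik] := @oriented_integral_sum R _ (index_enum 'I_d) h
  (fun i => 'D_(delta_mx 0 i) psi x) tau t hi.
exists (fun s => \sum_i 'D_(delta_mx 0 i) psi x * h i s); split => //.
  move=> s st.
  have -> : \sum_i 'D_(delta_mx 0 i) psi x * h i s - slope psi x (f (x, u s)) =
     slope psi x (f (y s, u s) - f (x, u s)).
    by rewrite -sumrB; apply: eq_bigr => i _; rewrite !mxE /h mulrBl mulrC.
  apply: le_trans (ddA _) _.
  have ys := disp s st; have sn := between_norm st.
  have yx : `|y s - x| <= 1 + `|x|.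
    apply: le_trans ys _; move: (le_lt_trans sn d1).
    rewrite -[X in _ < X -> _]mul1r ltr_pdivlMr ?mulr_gt0 // /C.
    have := normr_ge0 x; have := normr_ge0 (s - tau); nra.
  have xr : `|x| <= 2 * `|x| + 1 by have := normr_ge0 x; lra.
  have yr : `|y s| <= 2 * `|x| + 1.
    rewrite -[y s](subrKC x); apply: le_trans (ler_normD _ _) _; lra.
  have fL := HL _ _ (u s) yr xr.
  apply: (@le_trans _ _ (A * (L * (C * `|t - tau|)))).
    rewrite ler_wpM2l //; apply: le_trans fL _; rewrite ler_pM2l //.
    by apply: le_trans ys _; rewrite ler_pM2l.
  move: d3; rewrite ltr_pdivlMr // /K; have := normr_ge0 (t - tau).
  set q := `|t - tau|; nra.
have Ey : 'd psi x (y t - x) = oriented_integral tau t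
   (fun s => \sum_i 'D_(delta_mx 0 i) psi x * h i s).
  rewrite diff_row_partial // Ek; apply: eq_bigr => i _; rewrite mulrC; congr (_ * _).
  by have [_ /(_ x i)[_ E]] := flow tau t tauT tT; rewrite !mxE /y E addrC addKr.
rewrite -mulrBl -Ey normf_div ler_pdivrMr; last by rewrite normr_gt0 subr_eq0.
have yd := disp t (betweenr _ _).
have yd1 : `|y t - x| < del1.
  by apply: le_lt_trans yd _; rewrite mulrC -ltr_pdivlMr.
apply: le_trans (H1 _ yd1) _.
by rewrite mulrAC ler_pdivrMr // -mulrA ler_pM2l // [_ * C]mulrC.
Qed.

(** An inequality that holds for each value of U and involves several points can
    only be integrated if all the points are followed under the same control;
    hence the single integrand k for the whole linear combination. *)
Lemma increments_expansion (I : Type) (psi : I -> 'rV[R]_d -> R)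
    (x : I -> 'rV[R]_d) (c : I -> R) (l : seq I) (e : R) :
  (forall i, differentiable (psi i) (x i)) -> 0 < e ->
  exists2 del : R, 0 < del &
    forall u Phi t, controlled_flow f T u Phi -> t \in `[0, T] -> t != tau ->
      `|t - tau| < del ->
      exists k : R -> R,
      [/\ mu.-integrable `[Num.min tau t, Num.max tau t] (EFin \o k),
         forall s, between tau t s ->
           `|k s - \sum_(i <- l) c i * slope (psi i) (x i) (f (x i, u s))| <= e &
         `|\sum_(i <- l) c i * ((psi i (Phi tau t (x i)) - psi i (x i)) / (t - tau)) -
           oriented_integral tau t k / (t - tau)| <= e].
Proof.
move=> dpsi; elim: l e => [|i l IH] e e0.
  exists 1 => // u Phi t _ _ _ _; exists (fun=> 0); split.
  - by apply: continuous_integrable; exact: cst_continuous.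
  - by move=> s _; rewrite big_nil subrr normr0 ltW.
  - rewrite big_nil /oriented_integral !Rintegral_cst ?mul0r ?oppr0 ?if_same;
      try exact: itv_completed.
    by rewrite mul0r subrr normr0 ltW.
have e2 : 0 < e / 2 by rewrite divr_gt0.
have ec : 0 < e / 2 / (1 + `|c i|) by rewrite divr_gt0 // ltr_pwDl.
have [d1 d10 H1] := increment_expansion (dpsi i) ec.
have [d2 d20 H2] := IH _ e2.
exists (Num.min d1 d2); first by rewrite lt_min d10.
move=> u Phi t flow tT tt; rewrite lt_min => /andP[td1 td2].
have [k1 [i1 E1 F1]] := H1 u Phi t flow tT tt td1.
have [k2 [i2 E2 F2]] := H2 u Phi t flow tT tt td2.
have i1' : mu.-integrable `[Num.min tau t, Num.max tau t] (EFin \o (fun s => c i * k1 s)).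
  have := integrableZl (@itv_completed R _) (c i) i1.
  by apply: eq_integrable => //; exact: itv_completed.
have small (p : R) : `|p| <= e / 2 / (1 + `|c i|) -> `|c i * p| <= e / 2.
  rewrite ler_pdivlMr ?ltr_pwDl // normrM; have := normr_ge0 p.
  have := normr_ge0 (c i); nra.
exists (fun s => c i * k1 s + k2 s); split.
- have := integrableD (@itv_completed R _) i1' i2.
  by apply: eq_integrable => //; exact: itv_completed.
- move=> s st; rewrite big_cons opprD addrACA -mulrBr (splitr e).
  apply: le_trans (ler_normD _ _) _; apply: lerD; last exact: E2.
  exact/small/E1.
- rewrite big_cons oriented_integralD // oriented_integralZ //.
  rewrite [(_ * oriented_integral _ _ _ + _) / _]mulrDl opprD addrACA.
  rewrite -mulrA -mulrBr (splitr e).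
  apply: le_trans (ler_normD _ _) _; apply: lerD; last exact: F2.
  exact: small.
Qed.

End short_time.

(** * Limits of difference quotients of Koopman eigenvalues *)

Lemma increasing_seq_cvg (f : nat -> nat) : increasing_seq f -> f n @[n --> \oo] --> \oo.
Proof.
move=> fi; have fn n : (n <= f n)%N.
  elim: n => // n IH; apply: leq_ltn_trans IH _.
  by have /increasing_seqP := fi; exact.
by move=> A [N _ NA]; exists N => // n /= Nn; apply: NA; exact: leq_trans (fn n).
Qed.

Lemma bolzano_weierstrass_plane (R : realType) (a b : nat -> R) (B : R) :
  (forall n, `|a n| <= B) -> (forall n, `|b n| <= B) ->
  exists g : nat -> nat, [/\ g n @[n --> \oo] --> \oo,
    cvgn (a \o g) & cvgn (b \o g)].
Proof.
have bnd (c : nat -> R) : (forall n, `|c n| <= B) -> bounded_fun c.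
  move=> cB; exists B; split; first exact: num_real.
  by move=> x Bx n _; exact: le_trans (cB n) (ltW Bx).
move=> aB bB; have [g1 i1 c1] := bolzano_weierstrass (bnd a aB).
have [g2 i2 c2] := bolzano_weierstrass (bnd _ (fun n => bB (g1 n))).
have j1 := increasing_seq_cvg i1; have j2 := increasing_seq_cvg i2.
exists (g1 \o g2); split.
- exact: cvg_comp j2 j1.
- by apply/cvg_ex; exists (lim ((a \o g1) n @[n --> \oo])); exact: cvg_comp j2 c1.
- exact: c2.
Qed.

Section converse.
Context (R : realType) (d : nat) (U : metricType R) (T : R) (T_gt0 : 0 < T).
Context (f : 'rV[R]_d * U -> 'rV[R]_d) (U_compact : compact [set: U]).
Context (f_cont : continuous f).
Context (f_growth : exists m : R, 0 < m /\
      forall (x : 'rV[R]_d) (u : U), `|f (x, u)| <= m * (1 + `|x|))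
    (f_lip : forall K : set 'rV[R]_d, compact K ->
      exists l : R, 0 < l /\
        forall (x y : 'rV[R]_d) (u : U), K x -> K y ->
          `|f (x, u) - f (y, u)| <= l * `|x - y|).
Context (f_convex : convex_set (controlled_fields f)).
Context (tau : R) (tauT : tau \in `[0, T]).

Definition part (b : bool) (phi : 'rV[R]_d -> Cplx R) : 'rV[R]_d -> R :=
  if b then re_part phi else im_part phi.

Lemma velocity_continuous (psi : 'rV[R]_d -> R) x :
  continuous (fun u => slope psi x (f (x, u))).
Proof.
move=> u; apply: cvg_big => [|i _]; first exact: add_continuous.
apply: cvgM; last exact: cvg_cst.
have h2 : (x, u') @[u' --> u] --> (x, u).
  move=> A [[B C] /= [nB nC] BC]; apply: filterS nC => u' Cu'.
  by apply: BC; split => //=; exact: nbhs_singleton.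
have h1 := cvg_comp _ _ h2 (@f_cont (x, u)).
exact: (cvg_comp _ _ h1 (@coord_continuous R 1 d 0 i (f (x, u)))).
Qed.

Lemma velocity_convex u v (th : R) : 0 <= th <= 1 ->
  exists w, forall x, f (x, w) = th *: f (x, u) + (1 - th) *: f (x, v).
Proof.
move=> /andP[th0 th1].
have mf w : (fun x => f (x, w)) \in controlled_fields f by rewrite inE; exists w.
have := f_convex (Itv01 th0 th1) (mf u) (mf v).
rewrite inE => -[w _ E]; exists w => x.
by have := congr1 (fun g => g x) E.
Qed.

(** The equation to solve for u is a family of real equations indexed by the points
    x and by the choice of the real or the imaginary part. A linear inequality
    valid for all u passes to mu * phi by evaluating the increments of phi at a
    time tn n close to tau, where they equal (tn n - tau) * q n * phi and, once
    divided by tn n - tau, are within e / 3 of averages over time of quantities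
    that satisfy the inequality up to e / 3. *)
Lemma realised_eigenvalue (phi : 'rV[R]_d -> Cplx R) (tn : nat -> R)
    (q : nat -> Cplx R) (mu : Cplx R) :
  (forall x, differentiable (re_part phi) x) ->
  (forall x, differentiable (im_part phi) x) ->
  (forall n, tn n \in `[0, T] /\ tn n != tau) ->
  tn n @[n --> \oo] --> tau ->
  (forall n, exists u Phi, controlled_flow f T u Phi /\
    forall x, phi (Phi tau (tn n) x) - phi x = (tn n - tau)%:C * (q n * phi x)) ->
  complex.Re (q n) @[n --> \oo] --> complex.Re mu ->
  complex.Im (q n) @[n --> \oo] --> complex.Im mu ->
  exists u, grad_dot phi (fun x => f (x, u)) = mu *: phi.
Proof.
move=> dre dim tnT tntau flows qr qi.
have dpart b x : differentiable (part b phi) x by case: b.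
pose I := (bool * 'rV[R]_d)%type.
pose G u (i : I) := slope (part i.1 phi) i.2 (f (i.2, u)).
pose target (i : I) := part i.1 (fun x => mu * phi x) i.2.
have [u Hu] : exists u, forall i, G u i = target i.
  apply: convex_realisation => //.
  - by have [u _] := flows 0%N; exists (u tau).
  - by move=> i; exact: velocity_continuous.
  - move=> u v th /(velocity_convex u v) [w Hw]; exists w => i.
    rewrite /G !big_distrr /= -big_split /=; apply: eq_bigr => j _.
    by rewrite Hw !mxE; ring.
  move=> l c M HM; apply/ler_addgt0Pr => e e0.
  have e3 : 0 < e / 3 by rewrite divr_gt0.
  have [m [m0 fm]] := f_growth.
  have [del del0 Hdel] := @increments_expansion R d U T f m m0 fm
    (lipschitz_on_balls f_lip) tau tauT I (fun i => part i.1 phi) snd c l (e / 3)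
    (fun i => dpart i.1 i.2) e3.
  have cl : \sum_(i <- l) c i * part i.1 (fun x => q n * phi x) i.2 @[n --> \oo] -->
      \sum_(i <- l) c i * target i.
    apply: cvg_big => [|[b x] _]; first exact: add_continuous.
    apply: cvgM; first exact: cvg_cst.
    case: b; rewrite /target /part /re_part /im_part /=.
      under eq_fun do rewrite ReM; rewrite ReM.
      by apply: cvgB; apply: cvgM => //; exact: cvg_cst.
    under eq_fun do rewrite ImM; rewrite ImM.
    by apply: cvgD; apply: cvgM => //; exact: cvg_cst.
  have [n [n1 n2]] : exists n, `|tau - tn n| < del /\
    `|\sum_(i <- l) c i * target i -
      \sum_(i <- l) c i * part i.1 (fun x => q n * phi x) i.2| <= e / 3.
    have /cvgrPdist_le/(_ _ e3) [N1 _ H1] := cl.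
    have /cvgrPdist_lt/(_ _ del0) [N2 _ H2] := tntau.
    exists (maxn N1 N2); split.
      by apply: H2; rewrite /= leq_maxr.
    by apply: H1; rewrite /= leq_maxl.
  have [tT tt] := tnT n; have [u [Phi [flow incr]]] := flows n.
  rewrite distrC in n1.
  have [k [ki kE kF]] := Hdel u Phi _ flow tT tt n1.
  have Einc (i : I) : (part i.1 phi (Phi tau (tn n) i.2) - part i.1 phi i.2) / (tn n - tau) =
     part i.1 (fun x => q n * phi x) i.2.
    have tt' : tn n - tau != 0 by rewrite subr_eq0.
    have := incr i.2; case: i => -[] x /=; rewrite /part /re_part /im_part.
      by case: (phi x) => a b; case: (phi _) => a' b'; case: (q n) => p r [-> _];
        rewrite /= mul0r subr0 mulrAC divff // mul1r.
    by case: (phi x) => a b; case: (phi _) => a' b'; case: (q n) => p r [_ ->];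
      rewrite /= mul0r addr0 mulrAC divff // mul1r.
  rewrite (eq_bigr _ (fun i _ => congr1 (fun z => c i * z) (Einc i))) in kF.
  have kM : oriented_integral tau (tn n) k / (tn n - tau) <= M + e / 3.
    apply: oriented_integral_le => //; first by rewrite eq_sym.
    move=> s st; have := kE s st; rewrite ler_norml => /andP[_ h].
    by have := HM (u s); rewrite /G; move: h; lra.
  move: n2 kF kM; rewrite !ler_norml.
  set a := \sum_(_ <- _) _; set b := \sum_(_ <- _) _; set z := oriented_integral _ _ _ / _.
  move=> /andP[? ?] /andP[? ?] ?; lra.
exists u; apply/funext => x.
apply/eqP; rewrite eq_complex Re_grad_dot Im_grad_dot.
by rewrite [X in X == _](Hu (true, x)) [X in _ && (X == _)](Hu (false, x)) !eqxx.
Qed.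

Lemma increment_bounded (psi : 'rV[R]_d -> R) (x : 'rV[R]_d) :
  differentiable psi x ->
  exists del B : R, 0 < del /\
    forall u Phi t, controlled_flow f T u Phi -> t \in `[0, T] -> t != tau ->
      `|t - tau| < del -> `|(psi (Phi tau t x) - psi x) / (t - tau)| <= B.
Proof.
move=> dpsi; have [m [m0 fm]] := f_growth.
have [del del0 H] := @increment_expansion R d U T f m m0 fm
  (lipschitz_on_balls f_lip) tau tauT psi x 1 dpsi ltr01.
pose A := \sum_i (m * (1 + `|x|)) * `|'D_(delta_mx 0 i) psi x|.
exists del, (A + 2); split => // u Phi t flow tT tt td.
have [k [ki kE kF]] := H u Phi t flow tT tt td.
have kA s : between tau t s -> `|k s| <= A + 1.
  move=> st; have := kE s st; set v := \sum_(_ | _) _ => kv.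
  have : `|v| <= A.
    apply: le_trans (ler_norm_sum _ _ _) _; apply: ler_sum => i _.
    rewrite normrM ler_wpM2r //; apply: le_trans (coord_le_norm _ _) _; exact: fm.
  move=> vA; rewrite -[k s](subrK v) addrC.
  apply: le_trans (ler_normD _ _) _; exact: lerD.
have ik := oriented_integral_norm_le ki kA.
rewrite -[X in `|X|](subrK (oriented_integral tau t k / (t - tau))).
apply: le_trans (ler_normD _ _) _.
rewrite (_ : A + 2 = 1 + (A + 1)); last by ring.
apply: lerD => //; rewrite normf_div ler_pdivrMr //.
by rewrite normr_gt0 subr_eq0.
Qed.

(** The times are on the right of tau, or on its left if tau = T, so that they stay
    in [0, T]. *)
Lemma approaching_sequence (del : R) : 0 < del ->
  exists s : nat -> R, [/\ forall n, s n \in `[0, T] /\ s n != tau,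
    forall n, `|s n - tau| < del & s n @[n --> \oo] --> tau].
Proof.
move=> del0.
have [sg [sg0 sgd sgT]] : exists sg : R, [/\ sg != 0, `|sg| < del & 0 <= tau + sg <= T].
  move: tauT; rewrite in_itv /= => /andP[t0 tT].
  have [tT'|tT'] := ltP tau T.
    have h : 0 < Num.min (del / 2) (T - tau) by rewrite lt_min divr_gt0 // subr_gt0.
    exists (Num.min (del / 2) (T - tau)); rewrite gt_eqF // (gtr0_norm h); split => //.
      by rewrite gt_min; apply/orP; left; lra.
    have : Num.min (del / 2) (T - tau) <= T - tau by rewrite ge_min lexx orbT.
    lra.
  have h : 0 < Num.min (del / 2) T by rewrite lt_min divr_gt0.
  exists (- Num.min (del / 2) T); rewrite oppr_eq0 gt_eqF // normrN (gtr0_norm h); split => //.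
    by rewrite gt_min; apply/orP; left; lra.
  have : Num.min (del / 2) T <= T by rewrite ge_min lexx orbT.
  lra.
have hn n : 0 < @harmonic R n <= 1.
  by rewrite /harmonic /= invr_gt0 ltr0n invf_le1 ?ltr0n // ler1n.
exists (fun n => tau + sg * harmonic n); split.
- move=> n; split.
    rewrite in_itv; have /andP[h0 h1] := hn n.
    move: tauT; rewrite in_itv; move: h0 h1 sgT; rewrite /=.
    change (n.+1%:R^-1) with (@harmonic R n).
    set h := @harmonic R n => h0 h1 /andP[? ?] /andP[? ?].
    have : 0 <= h * (tau + sg) by rewrite mulr_ge0 // ltW.
    have : 0 <= h * (T - (tau + sg)) by rewrite mulr_ge0 ?subr_ge0 // ltW.
    have : 0 <= (1 - h) * tau by rewrite mulr_ge0 ?subr_ge0.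
    have : 0 <= (1 - h) * (T - tau) by rewrite mulr_ge0 ?subr_ge0.
    by rewrite -/h; lra.
  rewrite -subr_eq0 addrC addKr mulf_neq0 //.
  by have /andP[h0 _] := hn n; rewrite gt_eqF.
- move=> n; rewrite addrC addKr normrM; have /andP[h0 h1] := hn n.
  by rewrite (gtr0_norm h0); apply: le_lt_trans sgd; rewrite ler_piMr.
- rewrite -[X in _ --> X]addr0; apply: cvgD; first exact: cvg_cst.
  rewrite -[X in _ --> X](mulr0 sg); apply: cvgM; first exact: cvg_cst.
  exact: cvg_harmonic.
Qed.

(** The quotients are bounded because, for any x0 where phi does not vanish, they
    are the difference quotients of phi along the trajectory of x0, divided by
    phi x0. *)
Lemma infinitesimal_eigenvalue (lam : R -> Cplx R) (phi : 'rV[R]_d -> Cplx R) :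
  C1c phi -> phi != 0 ->
  (forall t : R, t \in `[0, T] -> Koopman f T tau t phi (lam t *: phi)) ->
  exists (tn : nat -> R) (mu : Cplx R),
  [/\ forall n, tn n \in `[0, T] /\ tn n != tau,
      tn n @[n --> \oo] --> tau,
      Liouville_spectrum f mu,
      complex.Re ((lam (tn n) - 1) / (tn n - tau)%:C) @[n --> \oo] --> complex.Re mu &
      complex.Im ((lam (tn n) - 1) / (tn n - tau)%:C) @[n --> \oo] --> complex.Im mu].
Proof.
move=> phiC1 phi0 lamK; have [dre dim _ _] := phiC1.
have [x0 phix0] : exists x0, phi x0 != 0.
  apply: contrapT => /forallNP h; move/eqP: phi0; apply; apply/funext => x.
  by apply: contrapT => /eqP; exact: h.
pose q t : Cplx R := (lam t - 1) / (t - tau)%:C.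
have qE t x (Phi : R -> R -> 'rV[R]_d -> 'rV[R]_d) : t != tau -> lam t *: phi = phi \o Phi tau t ->
    phi (Phi tau t x) - phi x = (t - tau)%:C * (q t * phi x).
  move=> tt E; rewrite /q mulrA mulrCA divff ?mulr1; last first.
    by rewrite eq_complex /= subr_eq0 negb_and tt.
  by rewrite mulrBl mul1r; have := congr1 (fun g => g x) E; rewrite /= => <-.
have [d1 [B1 [d10 H1]]] := increment_bounded (dre x0).
have [d2 [B2 [d20 H2]]] := increment_bounded (dim x0).
pose w : Cplx R := (phi x0)^-1.
pose B := B1 * `|complex.Re w| + B2 * `|complex.Im w| +
  (B1 * `|complex.Im w| + B2 * `|complex.Re w|).
have qB t : t \in `[0, T] -> t != tau -> `|t - tau| < Num.min d1 d2 ->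
    `|complex.Re (q t)| <= B /\ `|complex.Im (q t)| <= B.
  move=> tT tt; rewrite lt_min => /andP[td1 td2].
  have [u [Phi [_ flow E]]] := lamK t tT.
  have h1 := H1 u Phi t flow tT tt td1; have h2 := H2 u Phi t flow tT tt td2.
  have tt' : t - tau != 0 by rewrite subr_eq0.
  have Eq := qE t x0 Phi tt E.
  have Eqw : q t = (q t * phi x0) * w by rewrite -mulrA divff ?mulr1.
  have Er : (re_part phi (Phi tau t x0) - re_part phi x0) / (t - tau) =
      complex.Re (q t * phi x0).
    move: Eq; rewrite /re_part; case: (phi x0) => a b; case: (phi _) => a' b'.
    case: (q t) => p r [-> _]; rewrite /= mul0r subr0 mulrAC divff // mul1r //.
  have Ei : (im_part phi (Phi tau t x0) - im_part phi x0) / (t - tau) =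
      complex.Im (q t * phi x0).
    move: Eq; rewrite /im_part; case: (phi x0) => a b; case: (phi _) => a' b'.
    case: (q t) => p r [_ ->]; rewrite /= mul0r addr0 mulrAC divff // mul1r //.
  rewrite Er in h1; rewrite Ei in h2.
  rewrite Eqw (ReM (q t * phi x0) w) (ImM (q t * phi x0) w) /B; move: h1 h2.
  set p := complex.Re (_ * _); set r := complex.Im (_ * _).
  have w1 := normr_ge0 (complex.Re w); have w2 := normr_ge0 (complex.Im w).
  have p0 := normr_ge0 p; have r0 := normr_ge0 r => pB rB.
  have m1 : `|p| * `|complex.Re w| <= B1 * `|complex.Re w| by rewrite ler_wpM2r.
  have m2 : `|p| * `|complex.Im w| <= B1 * `|complex.Im w| by rewrite ler_wpM2r.
  have m3 : `|r| * `|complex.Re w| <= B2 * `|complex.Re w| by rewrite ler_wpM2r.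
  have m4 : `|r| * `|complex.Im w| <= B2 * `|complex.Im w| by rewrite ler_wpM2r.
  have z1 := mulr_ge0 p0 w1; have z2 := mulr_ge0 p0 w2.
  have z3 := mulr_ge0 r0 w1; have z4 := mulr_ge0 r0 w2.
  split.
    by apply: le_trans (ler_normB _ _) _; rewrite !normrM; lra.
  by apply: le_trans (ler_normD _ _) _; rewrite !normrM; lra.
have d0 : 0 < Num.min d1 d2 by rewrite lt_min d10.
have [s [sT sd stau]] := approaching_sequence d0.
have [g [goo cr ci]] := @bolzano_weierstrass_plane R
  (fun n => complex.Re (q (s n))) (fun n => complex.Im (q (s n))) B
  (fun n => (qB _ (sT n).1 (sT n).2 (sd n)).1) (fun n => (qB _ (sT n).1 (sT n).2 (sd n)).2).
pose mu : Cplx R := lim ((fun n => complex.Re (q (s n))) \o g @ \oo) +i*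
   lim ((fun n => complex.Im (q (s n))) \o g @ \oo).
exists (s \o g), mu.
have tn1 n : (s \o g) n \in `[0, T] /\ (s \o g) n != tau by exact: sT.
have tn2 : (s \o g) n @[n --> \oo] --> tau by exact: cvg_comp goo stau.
split => //.
have flows n : exists u Phi, controlled_flow f T u Phi /\ forall x,
    phi (Phi tau ((s \o g) n) x) - phi x =
    ((s \o g) n - tau)%:C * (q (s (g n)) * phi x).
  have [tT tt] := tn1 n; have [u [Phi [_ flow E]]] := lamK _ tT.
  by exists u, Phi; split => // x; exact: qE tt E.
have [u Hu] := @realised_eigenvalue phi (s \o g) (fun n => q (s (g n))) mu
  dre dim tn1 tn2 flows cr ci.
by exists phi; split => //; exists u.
Qed.

End converse.

(** * Derivative of the complex exponential along a sequence *)

Lemma derive_along_sequence (R : realType) (g : R -> R) (l : R) (h : nat -> R) :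
  is_derive (0 : R) (1 : R) g l -> (forall n, h n != 0) -> h n @[n --> \oo] --> 0 ->
  (g (h n) - g 0) / h n @[n --> \oo] --> l.
Proof.
move=> [dg <-] h0 hto.
have H : h n @[n --> \oo] --> (0 : R)^'.
  move=> A nA; have : \forall n \near \oo, h n != 0 -> A (h n) by exact: (hto _ nA).
  by apply: filterS => n; apply.
have := cvg_comp _ _ H dg.
apply: cvg_trans; apply: near_eq_cvg; near=> n.
by rewrite /= addr0 [h n *: 1]mulr1 [_ *: _]mulrC.
Unshelve. all: by end_near. Qed.

Lemma cexp_derivative_sequence (R : realType) (lambda : Cplx R) (h : nat -> R) :
  (forall n, h n != 0) -> h n @[n --> \oo] --> 0 ->
  complex.Re ((cexp (lambda * (h n)%:C) - 1) / (h n)%:C) @[n --> \oo] --> complex.Re lambda /\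
  complex.Im ((cexp (lambda * (h n)%:C) - 1) / (h n)%:C) @[n --> \oo] --> complex.Im lambda.
Proof.
move=> h0 hto; case: lambda => al be.
have dE (s : R) : is_derive s (1 : R) (fun s => expR (al * s)) (expR (al * s) * al).
  exact: is_derive_rescale.
have dC (s : R) : is_derive s (1 : R) (fun s => cos (be * s)) (- sin (be * s) * be).
  exact: is_derive_rescale.
have dS (s : R) : is_derive s (1 : R) (fun s => sin (be * s)) (cos (be * s) * be).
  exact: is_derive_rescale.
have dr : is_derive (0 : R) (1 : R) (fun s => expR (al * s) * cos (be * s)) al.
  by apply: is_derive_eq; rewrite /GRing.scale /= !mulr0 expR0 cos0 sin0; ring.
have di : is_derive (0 : R) (1 : R) (fun s => expR (al * s) * sin (be * s)) be.
  by apply: is_derive_eq; rewrite /GRing.scale /= !mulr0 expR0 cos0 sin0; ring.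
have lr := derive_along_sequence dr h0 hto; have li := derive_along_sequence di h0 hto.
move: lr li; rewrite !mulr0 expR0 cos0 sin0 mulr0 mulr1 => lr li.
split.
  apply: cvg_trans lr; apply: near_eq_cvg; apply: nearW => n.
  cbn beta; rewrite Re_div_real /cexp /=; congr (_ / _).
  by rewrite !mulr0 !subr0 add0r mul0r subr0.
apply: cvg_trans li; apply: near_eq_cvg; apply: nearW => n.
cbn beta; rewrite Im_div_real /cexp /=; congr (_ / _).
by rewrite !mulr0 !subr0 add0r mul0r ?addr0 ?oppr0 ?addr0 ?subr0.
Qed.

Theorem theorem4p14 (R : realType) (d : nat) (U : metricType R) (T : R)
    (f : 'rV[R]_d * U -> 'rV[R]_d)
    (T_gt0 : 0 < T)
    (U_compact : compact [set: U])
    (f_cont : continuous f)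
    (f_growth : exists m : R, 0 < m /\
      forall (x : 'rV[R]_d) (u : U), `|f (x, u)| <= m * (1 + `|x|))
    (f_lip : forall K : set 'rV[R]_d, compact K ->
      exists l : R, 0 < l /\
        forall (x y : 'rV[R]_d) (u : U), K x -> K y ->
          `|f (x, u) - f (y, u)| <= l * `|x - y|) :
  (forall tau t : R, tau \in `[0, T] -> t \in `[tau, T] ->
    exp_scaled (Liouville_spectrum f) (t - tau)
      `<=` Koopman_spectrum f T tau t /\
    (forall (lambda : Cplx R) (phi : 'rV[R]_d -> Cplx R),
      eigenvector (@C1c R d) (Liouville f) lambda phi ->
      eigenvector (@C0c R d) (Koopman f T tau t)
        (cexp (lambda * (t - tau)%:C)) phi)) /\
  (convex_set (controlled_fields f) ->
    (forall tau : R, tau \in `[0, T] ->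
      forall (lam : R -> Cplx R) (phi : 'rV[R]_d -> Cplx R),
        lebesgue_measurable `[0, T] lam ->
        C1c phi -> phi != 0 ->
        (forall t : R, t \in `[0, T] -> Koopman f T tau t phi (lam t *: phi)) ->
        exists tn : nat -> R,
          [/\ forall n, tn n \in `[0, T] /\ tn n != tau,
              tn n @[n --> \oo] --> tau,
              lam (tn n) @[n --> \oo] --> (1 : Cplx R) &
              exists2 mu : Cplx R, Liouville_spectrum f mu &
                (lam (tn n) - 1) / (tn n - tau)%:C @[n --> \oo] --> mu]) /\
    (forall tau t : R, tau \in `[0, T] -> t \in `[0, T] ->
      exponential_Koopman_values f T tau t
        `<=` exp_scaled (Liouville_spectrum f) (t - tau))).
Proof.
split.
  move=> tau t tauT tT; split; last first.
    by move=> lambda phi; exact: Liouville_eigenvector_Koopman.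
  move=> _ [lambda [phi eig] <-]; exists phi.
  exact: Liouville_eigenvector_Koopman.
move=> f_convex; split.
  move=> tau tauT lam phi _ phiC1 phi0 lamK.
  have [tn [mu [tnT tntau spec qr qi]]] := infinitesimal_eigenvalue T_gt0 U_compact
    f_cont f_growth f_lip f_convex tauT phiC1 phi0 lamK.
  have qmu : (lam (tn n) - 1) / (tn n - tau)%:C @[n --> \oo] --> mu.
    exact: (@Cplx_cvg R _ \oo _ _ mu qr qi).
  exists tn; split; [exact: tnT | exact: tntau | | by exists mu; [exact: spec | exact: qmu]].
  have h0 : tn n - tau @[n --> \oo] --> 0.
    by rewrite -(subrr tau); apply: cvgB; [exact: tntau | exact: cvg_cst].
  have lE n : lam (tn n) = (lam (tn n) - 1) / (tn n - tau)%:C * (tn n - tau)%:C + 1.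
    rewrite divfK ?subrK //; have [_ tt] := tnT n.
    by rewrite eq_complex /= subr_eq0 negb_and tt.
  have lr : complex.Re (lam (tn n)) @[n --> \oo] --> complex.Re (1 : Cplx R).
    rewrite -[X in _ --> X]add0r -(mulr0 (complex.Re mu)).
    under eq_fun do rewrite lE Re_affine_real.
    by apply: cvgD; [exact: cvgM | exact: cvg_cst].
  have li : complex.Im (lam (tn n)) @[n --> \oo] --> complex.Im (1 : Cplx R).
    rewrite (_ : complex.Im (1 : Cplx R) = complex.Im mu * 0); last by rewrite mulr0.
    under eq_fun do rewrite lE Im_affine_real.
    exact: cvgM.
  exact: (@Cplx_cvg R _ \oo _ _ 1 lr li).
move=> tau t tauT tT _ [lambda [phi [phiC1 phi0 lamK]] <-].
have [tn [mu [tnT tntau spec qr qi]]] := infinitesimal_eigenvalue T_gt0 U_compact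
    f_cont f_growth f_lip f_convex tauT phiC1 phi0 lamK.
exists lambda => //.
have h0 : tn n - tau @[n --> \oo] --> 0.
  by rewrite -(subrr tau); apply: cvgB; [exact: tntau | exact: cvg_cst].
have hn n : tn n - tau != 0 by rewrite subr_eq0; have [] := tnT n.
have [lr li] := cexp_derivative_sequence lambda hn h0.
(* mu and lambda are limits of the same quotients *)
suff -> : lambda = mu by [].
apply/eqP; rewrite eq_complex; apply/andP; split; apply/eqP.
  exact: (cvg_unique _ lr qr).
exact: (cvg_unique _ li qi).
Qed.
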